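(* For any fixed $k\ge2$, if $m=o(\sqrt n)$ and $m$ is not divisible by $k$, then with high probability (over the random utilities, as $n\to\infty$) no envy-free outcome exists.
   Context: Random variable-group model: $k\ge2$ is a fixed integer; $N=[n]$ is a set of $n$ agents with $n$ divisible by $k$; $M=[m]$ is a set of $m\ge1$ goods, where $m=m(n)$ may depend on $n$. All groups have the same desired size $n/k$. A fixed distribution $\mathcal D$ is given that is non-atomic (puts zero probability on every single point) and has support contained in $[0,1]$. For each $a\in N$, $g\in M$, the utility $u_a(g)$ is drawn independently from $\mathcal D$, and utilities are additive: $u_a(M')=\sum_{g\in M'}u_a(g)$. An outcome $(C,A)$ consists of a partition $C=(C_1,\dots,C_k)$ of $N$ with $|C_i|=n/k$ for all $i$, and a complete allocation $A=(A_1,\dots,A_k)$, i.e. a partition of $M$ into $k$ disjoint, possibly empty bundles. It is envy-free if $u_a(A_i)\ge u_a(A_j)$ for all $i,j\in[k]$ and $a\in C_i$. ''With high probability'' means with probability approaching $1$ as $n\to\infty$. *)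

(* Defs.v *)
From HB Require Import structures.
From mathcomp Require Import all_boot all_order all_algebra.
From mathcomp Require Import all_classical all_reals all_analysis.

Set Implicit Arguments.
Unset Strict Implicit.
Unset Printing Implicit Defensive.

Import Order.TTheory GRing.Theory Num.Theory.
Import numFieldNormedType.Exports.

Local Open Scope classical_set_scope.
Local Open Scope ring_scope.

Section Distributions.
Context {R : realType}.
Implicit Type D : probability (measurableTypeR R) R.

Definition non_atomic D : Prop := forall x : R, D [set x] = 0%E.

Definition support_of D : set R :=
  [set x : R | forall U : set R, open U -> U x -> (0 < D U)%E].

End Distributions.

Section Independence.
Context d (T : measurableType d) (R : realType) (P : probability T R).

Definition mutually_independent (I : finType) (X : I -> {RV P >-> R}) : Prop :=
  forall (J : {set I}) (B : I -> set R),
    (forall i, measurable (B i)) ->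
    P (\bigcap_(i in [set` J]) (X i @^-1` B i)) =
    (\prod_(i in J) P (X i @^-1` B i))%E.

Definition has_law (D : probability (measurableTypeR R) R)
    (X : {RV P >-> R}) : Prop :=
  forall B : set R, measurable B -> distribution P X B = D B.

Definition iid_utilities (D : probability (measurableTypeR R) R) (n m : nat)
    (u : 'I_n -> 'I_m -> {RV P >-> R}) : Prop :=
  mutually_independent (fun ag : 'I_n * 'I_m => u ag.1 ag.2) /\
  forall a g, has_law D (u a g).

End Independence.

(* Indexed partition; unlike in finset's [partition], parts may be empty. *)
Definition indexed_partition (T : finType) (k : nat)
    (S : {ffun 'I_k -> {set T}}) : Prop :=
  (forall i j, i != j -> (S i :&: S j)%SET = finset.set0) /\
  (\bigcup_(i < k) S i)%SET = [set: T]%SET.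

Definition is_outcome (n m k : nat) (C : {ffun 'I_k -> {set 'I_n}})
    (A : {ffun 'I_k -> {set 'I_m}}) : Prop :=
  [/\ indexed_partition C,
      forall i, #|C i| = (n %/ k)%N
    & indexed_partition A].

Section EnvyFreeness.
Context (R : realType) (n m k : nat).

Definition bundle_utility (v : 'I_m -> R) (B : {set 'I_m}) : R :=
  \sum_(g in B) v g.

Definition envy_free (v : 'I_n -> 'I_m -> R) (C : {ffun 'I_k -> {set 'I_n}})
    (A : {ffun 'I_k -> {set 'I_m}}) : Prop :=
  forall (i j : 'I_k) (a : 'I_n), a \in C i ->
    bundle_utility (v a) (A j) <= bundle_utility (v a) (A i).

Definition envy_free_outcome_exists (v : 'I_n -> 'I_m -> R) : Prop :=
  exists (C : {ffun 'I_k -> {set 'I_n}}) (A : {ffun 'I_k -> {set 'I_m}}),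
    is_outcome C A /\ envy_free v C A.

End EnvyFreeness.

Arguments envy_free_outcome_exists {R n m} k v.

(* Main.v *)
Require Import Defs.
From HB Require Import structures.
From mathcomp Require Import all_boot all_order all_algebra.
From mathcomp Require Import all_classical all_reals all_analysis.
From mathcomp Require Import fingroup perm measurable_realfun ring lra.
Import Order.TTheory GRing.Theory Num.Theory.
Import numFieldNormedType.Exports.
Local Open Scope classical_set_scope.
Local Open Scope ring_scope.

(*
Let A_s be a bundle of minimal size. In an envy-free outcome the n/k agents of
C_s all weakly prefer A_s to every other bundle, so it suffices to show that,
for a fixed allocation, an agent has A_s among its favourites with probability
at most 1/k - delta, where delta is of order 1/sqrt m: Chernoff's bound then
gives probability at most exp(-c n/m) for n/k such agents, and the 2^(km)
allocations are absorbed by a union bound because m^2 = o(n).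

Since k does not divide m, some A_l is strictly larger than A_s. Truncating all
bundles to t = |A_s| goods, except for one extra good z kept in A_l, only makes
A_s more attractive. The truncated sums Y_j are iid and atomless, so Y_s is the
largest with probability 1/k; the gain delta comes from the event that Y_s is
the largest but exceeds Y_l by less than u(z). To bound its probability from
below, cut a window of length O(sqrt t), which contains Y_j with probability at
least 3/4 by Chebyshev, into O(sqrt t) bins of fixed width: by Cauchy-Schwarz
two given sums meet in a bin above the median with probability of order
1/sqrt t.

Independence of disjoint blocks of variables is obtained by reading one block in
a second independent copy of the sample space, which does not change the joint
law.
*)

(** * Joint laws of finite iid families *)

Section JointLaw.
Set Implicit Arguments.
Unset Strict Implicit.
Context {R : realType}.

Definition rects (I : finType) : set (set (I -> R)) :=
  [set S | exists2 B : I -> set R,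
    (forall i, measurable (B i)) & S = [set v | forall i, B i (v i)]].

Arguments rects : clear implicits.

(** Real vectors indexed by [I] with the product sigma-algebra, presented by the pi-system of
    rectangles. *)
Definition vecs (I : finType) := g_sigma_algebraType (rects I).

(** [D] is a bare set function, so that the image of [P] under a derived variable can take its
    place. As [B i] may be the whole line and [D setT = 1], full rectangles also cover every
    subfamily. *)
Definition iid_law (D : set R -> \bar R) {d} {T : measurableType d}
    (P : set T -> \bar R) {I : finType} (X : I -> T -> R) : Prop :=
  [/\ D setT = 1%E,
      forall i, measurable_fun setT (X i)
    & forall B : I -> set R, (forall i, measurable (B i)) ->
        P [set w | forall i, B i (X i w)] = (\prod_i D (B i))%E].

Lemma measurable_set_le {d} {T : measurableType d} (f g : T -> R) :
  measurable_fun setT f -> measurable_fun setT g ->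
  measurable [set w | f w <= g w].
Proof.
move=> mf mg.
have := measurable_fun_ler mf mg measurableT (Y := [set true]).
by rewrite setTI preimage_true; exact.
Qed.

Lemma measurable_set_lt {d} {T : measurableType d} (f g : T -> R) :
  measurable_fun setT f -> measurable_fun setT g ->
  measurable [set w | f w < g w].
Proof.
move=> mf mg.
have := measurable_fun_ltr mf mg measurableT (Y := [set true]).
by rewrite setTI preimage_true; exact.
Qed.

Lemma measurable_set_eq {d} {T : measurableType d} (f g : T -> R) :
  measurable_fun setT f -> measurable_fun setT g ->
  measurable [set w | f w = g w].
Proof.
move=> mf mg; rewrite (_ : [set w | _] = [set w | f w <= g w] `&`
    [set w | g w <= f w]).
  by apply: measurableI; exact: measurable_set_le.
apply/seteqP; split=> w /= => [->|[fg gf]]; first by rewrite lexx.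
by apply/eqP; rewrite eq_le fg.
Qed.

Lemma measurable_coord (I : finType) (i : I) :
  measurable_fun setT (fun v : vecs I => v i : R).
Proof.
move=> _ B mB; rewrite setTI; apply: sub_sigma_algebra.
exists (fun j => if j == i then B else setT); first by move=> j; case: ifP.
apply/seteqP; split=> v /= => [Bv j|/(_ i)]; last by rewrite eqxx.
by case: eqP => [->|].
Qed.

Lemma measurable_forall {d} {T : measurableType d} (I : finType)
    (S : I -> set T) :
  (forall i, measurable (S i)) -> measurable [set w | forall i, S i w].
Proof.
move=> mS; rewrite (_ : [set w | _] = \bigcap_(i in [set: I]) S i).
  by apply: fin_bigcap_measurable => //; exact: finite_finset.
by apply/seteqP; split=> w /= h i *; exact: h.
Qed.

Lemma measurable_vector {d} {T : measurableType d} (I : finType)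
    (X : I -> T -> R) :
  (forall i, measurable_fun setT (X i)) ->
  measurable_fun setT (fun w => X ^~ w : vecs I).
Proof.
move=> mX.
apply: (@measurability _ _ T (vecs I) setT _ (rects I) erefl) => //.
move=> S [_ [B mB ->] <-].
rewrite setTI; apply: measurable_forall => i.
by rewrite -[X in measurable X]setTI; exact: mX.
Qed.

(** Both joint laws agree on rectangles, a pi-system generating the sigma-algebra, so uniqueness of
    finite measures applies. *)
Lemma iid_law_transfer (D : set R -> \bar R) d1 (T1 : measurableType d1)
    (P1 : probability T1 R) d2 (T2 : measurableType d2)
    (P2 : probability T2 R) (I : finType) (X1 : I -> T1 -> R)
    (X2 : I -> T2 -> R) :
  iid_law D P1 X1 -> iid_law D P2 X2 ->
  forall S : set (vecs I), measurable S ->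
    P1 [set w | S (X1 ^~ w)] = P2 [set w | S (X2 ^~ w)].
Proof.
move=> [D1 mX1 PX1] [_ mX2 PX2] S mS.
have mV1 := measurable_vector mX1; have mV2 := measurable_vector mX2.
pose X1' : {mfun T1 >-> vecs I} := HB.pack (fun w => X1 ^~ w : vecs I)
  (isMeasurableFun.Build _ _ _ _ _ mV1).
pose X2' : {mfun T2 >-> vecs I} := HB.pack (fun w => X2 ^~ w : vecs I)
  (isMeasurableFun.Build _ _ _ _ _ mV2).
apply: (@measure_unique _ R (vecs I) (rects I) (fun=> setT) _ _ _ _
  (distribution P1 X1') (distribution P2 X2')) => //.
- move=> _ _ [B mB ->] [C mC ->]; exists (fun i => B i `&` C i).
    by move=> i; exact: measurableI.
  apply/seteqP; split=> v /=; first by move=> [h1 h2] i; split.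
  by move=> h; split=> i; have [] := h i.
- move=> _; exists (fun=> setT) => //.
  by apply/seteqP; split.
- by rewrite bigcup_const.
- by move=> _ [B mB ->]; exact: etrans (PX1 B mB) (esym (PX2 B mB)).
- by move=> _; rewrite -ge0_fin_numE// fin_num_measure.
Qed.

End JointLaw.

(** * Operations that keep a family iid *)

Section IidOperations.
Set Implicit Arguments.
Unset Strict Implicit.
Context {R : realType}.

Lemma iid_law_marginal (D : set R -> \bar R) d (T : measurableType d)
    (P : set T -> \bar R) (I : finType) (X : I -> T -> R) i B :
  iid_law D P X -> measurable B -> P (X i @^-1` B) = D B.
Proof.
move=> [D1 _ PX] mB.
rewrite (_ : _ @^-1` _ =
    [set w | forall j, (if j == i then B else setT) (X j w)]); last first.
  apply/seteqP; split=> w /=; last by move=> /(_ i); rewrite eqxx.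
  by move=> Bw j; case: eqP => [->|].
rewrite (PX (fun j => if j == i then B else setT)); last first.
  by move=> j; case: ifP.
rewrite (bigD1 i)//= eqxx big1 ?mule1// => j /negPf ->; exact: D1.
Qed.

Lemma iid_law_reindex (D : set R -> \bar R) d (T : measurableType d)
    (P : set T -> \bar R) (I J : finType) (X : I -> T -> R) (f : J -> I) :
  injective f -> iid_law D P X -> iid_law D P (fun j => X (f j)).
Proof.
move=> finj [D1 mX PX]; split => // B mB.
(* Coordinates outside the range of [f] are left free and contribute a factor 1. *)
pose B' i := if [pick j | f j == i] is Some j then B j else setT.
have B'f j : B' (f j) = B j.
  rewrite /B'; case: pickP => [j' /eqP/finj -> //|/(_ j)]; by rewrite eqxx.
rewrite (_ : [set w | _] = [set w | forall i, B' i (X i w)]); last first.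
  apply/seteqP; split=> w /= h i; last by rewrite -B'f; exact: h.
  by rewrite /B'; case: pickP => [j /eqP <-|].
rewrite (PX B'); last by move=> i; rewrite /B'; case: pickP.
rewrite (bigID [in [set f j | j : J]%SET])/= [X in (_ * X)%E]big1 ?mule1.
  rewrite big_imset/=; last by move=> ? ? _ _; exact: finj.
  by apply: eq_bigr => j _; rewrite B'f.
move=> i /imsetP fi; rewrite /B'; case: pickP => [j /eqP fj|//].
by exfalso; apply: fi; exists j.
Qed.

(* Replaces a variable whose law sits on [A] by a variable with values in [A]
   everywhere, without changing the joint law. *)
Lemma iid_law_comp (D : probability (measurableTypeR R) R) d
    (T : measurableType d) (P : set T -> \bar R) (I : finType)
    (X : I -> T -> R) (f : R -> R) (A : set R) :
  measurable_fun setT f -> measurable A -> D (~` A) = 0%E ->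
  (forall x, A x -> f x = x) ->
  iid_law D P X -> iid_law D P (fun i w => f (X i w)).
Proof.
move=> mf mA DA fA [D1 mX PX]; split => //.
  by move=> i; exact: measurableT_comp.
move=> B mB; rewrite (PX (fun i => f @^-1` B i)); last first.
  by move=> i; rewrite -[X in measurable X]setTI; exact: mf.
apply: eq_bigr => i _.
have mfB : measurable (f @^-1` B i).
  by rewrite -[X in measurable X]setTI; exact: mf.
(* Only the trace on [A] carries mass, and there [f] is the identity. *)
have E (S : set R) : measurable S -> D S = D (S `&` A).
  move=> mS; rewrite -[in LHS](setIT S) -(setUv A) setIUr measureU//.
  - rewrite [X in (_ + X)%E](_ : _ = 0%E) ?adde0//.
    by apply: subset_measure0 DA => //; [exact: measurableI (measurableC _)|
      exact: measurableC].
  - exact: measurableI.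
  - by apply: measurableI => //; exact: measurableC.
  - by rewrite setIACA setICr setI0.
rewrite E// [RHS]E//; congr (D _); apply/seteqP.
by split=> x /= [Bx Ax]; split=> //; move: Bx; rewrite fA.
Qed.

(* Two independent copies of the sample space: coordinates in [J] are read in
   the first one, the others in the second one. *)
Definition mix {T : Type} {I : finType} (J : pred I) (X : I -> T -> R)
    (i : I) (w : T * T) : R := if J i then X i w.1 else X i w.2.

(** Each coordinate is constrained in exactly one of the two copies, so a rectangle event is a
    product of two events whose probabilities are complementary partial products. *)
Lemma iid_law_mix (D : set R -> \bar R) d (T : measurableType d)
    (P : probability T R) (I : finType) (X : I -> T -> R) (J : pred I) :
  iid_law D P X -> iid_law D (P \x P)%E (mix J X).
Proof.
move=> [D1 mX PX]; split => //.
  by move=> i; rewrite /mix; case: (J i); apply: measurableT_comp => //.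
move=> B mB.
pose B1 i := if J i then B i else setT; pose B2 i := if J i then setT else B i.
have mB1 i : measurable (B1 i) by rewrite /B1; case: ifP.
have mB2 i : measurable (B2 i) by rewrite /B2; case: ifP.
have mE (C : I -> set R) : (forall i, measurable (C i)) ->
    measurable [set w | forall i, C i (X i w)].
  move=> mC; apply: measurable_forall => i.
  by rewrite -[X in measurable X]setTI; exact: mX.
rewrite (_ : [set w | _] = [set w | forall i, B1 i (X i w)] `*`
    [set w | forall i, B2 i (X i w)]); last first.
  apply/seteqP; split=> -[w1 w2]/=; rewrite /mix/=.
    by move=> h; split=> i; have := h i; rewrite /B1 /B2; case: ifP.
  by move=> [h1 h2] i; have := h1 i; have := h2 i; rewrite /B1 /B2; case: ifP.
rewrite product_measure1E; [|exact: mE|exact: mE].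
rewrite [X in (X * _)%E](PX B1 mB1) [X in (_ * X)%E](PX B2 mB2) -big_split/=.
apply: eq_bigr => i _.
by rewrite /B1 /B2; case: ifP => _; rewrite D1 ?mule1 ?mul1e.
Qed.

End IidOperations.

(** * Independence of disjoint blocks of coordinates *)

Section Independence.
Set Implicit Arguments.
Unset Strict Implicit.
Context {R : realType}.

Definition depends_on {I : finType} {A : Type} (J : pred I)
    (F : (I -> R) -> A) : Prop :=
  forall v v' : I -> R, (forall i, J i -> v i = v' i) -> F v = F v'.

Lemma measurable_vector_event {d} {T : measurableType d} (D : set R -> \bar R)
    (P : set T -> \bar R) (I : finType) (X : I -> T -> R) (S : set (vecs I)) :
  iid_law D P X -> measurable S -> measurable [set w | S (X ^~ w)].
Proof.
by move=> [_ mX _] mS; have := measurable_vector mX measurableT mS; rewrite setTI.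
Qed.

(** Under [mix J], [S1] reads only the first copy and [S2] only the second, so their conjunction is
    a product event. *)
Lemma iid_law_indep (D : set R -> \bar R) d (T : measurableType d)
    (P : probability T R) (I : finType) (X : I -> T -> R) (J : pred I)
    (S1 S2 : set (vecs I)) :
  iid_law D P X -> measurable S1 -> measurable S2 ->
  depends_on J S1 -> depends_on (predC J) S2 ->
  P [set w | S1 (X ^~ w) /\ S2 (X ^~ w)] =
  (P [set w | S1 (X ^~ w)] * P [set w | S2 (X ^~ w)])%E.
Proof.
move=> iidX mS1 mS2 dS1 dS2.
have iidM := iid_law_mix J iidX.
have := @iid_law_transfer R D _ _ P _ _ (P \x P)%E I X (mix J X) iidX iidM
  _ (measurableI _ _ mS1 mS2).
rewrite /setI/= => ->.
rewrite -product_measure1E; [|exact: measurable_vector_event iidX mS1|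
  exact: measurable_vector_event iidX mS2].
congr ((P \x P)%E _); apply/seteqP; split=> -[w1 w2]/= [h1 h2]; split.
- by rewrite -(dS1 (mix J X ^~ (w1, w2)))// => i Ji; rewrite /mix Ji.
- by rewrite -(dS2 (mix J X ^~ (w1, w2)))// => i /negPf/= Ji; rewrite /mix Ji.
- by rewrite (dS1 _ (X ^~ w1))// => i Ji; rewrite /mix Ji.
- by rewrite (dS2 _ (X ^~ w2))// => i /negPf/= Ji; rewrite /mix Ji.
Qed.

(** Induction over the blocks: one block is split off from the others, whose joint event depends
    only on coordinates outside it. *)
Lemma iid_law_indep_blocks (D : set R -> \bar R) d (T : measurableType d)
    (P : probability T R) (I K : finType) (blk : I -> K) (X : I -> T -> R)
    (S : K -> set (vecs I)) (J : {set K}) :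
  iid_law D P X -> (forall a, measurable (S a)) ->
  (forall a, depends_on (fun i => blk i == a) (S a)) ->
  P [set w | forall a, a \in J -> S a (X ^~ w)] =
  (\prod_(a in J) P [set w | S a (X ^~ w)])%E.
Proof.
move=> iidX mS dS; rewrite -big_enum/=.
rewrite (_ : [set w | _] = [set w | forall a, a \in enum J -> S a (X ^~ w)]);
  last by apply/seteqP; split=> w /= h a aJ; apply: h; rewrite mem_enum in aJ *.
elim: (enum J) (enum_uniq J) => [_|b s IH /= /andP[bs us]].
  rewrite big_nil (_ : [set w | _] = setT) ?probability_setT//.
  by apply/seteqP; split.
rewrite big_cons -IH//.
pose S2 : set (vecs I) := [set v | forall a, a \in s -> S a v].
rewrite (_ : [set w | _] = [set w | S b (X ^~ w) /\ S2 (X ^~ w)]); last first.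
  apply/seteqP; split=> w /= h.
    by split=> [|a as_]; apply: h; rewrite inE ?eqxx ?as_ ?orbT.
  by move=> a; rewrite inE => /predU1P[->|]; [exact: h.1|exact: h.2].
apply: (iid_law_indep (J := fun i => blk i == b) iidX) => //.
- rewrite (_ : S2 = [set v | forall a, (if a \in s then S a else setT) v]).
    by apply: measurable_forall => a; case: ifP.
  by apply/seteqP; split=> v /= h a; have := h a; case: ifP => // _; exact.
- move=> v v' vv'; apply/propext; split=> h a as_; have := h a as_;
    rewrite (dS a v v')// => i /eqP ia; apply: vv' => /=;
    by rewrite ia; apply: contraNneq bs => <-.
Qed.

(** With [X i] read in a second copy, the first copy fixes the value of [f]; every section of the
    tie is then the preimage of a point, hence null. *)
Lemma iid_law_tie (D : set R -> \bar R) d (T : measurableType d)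
    (P : probability T R) (I : finType) (X : I -> T -> R) (i : I)
    (f : vecs I -> R) :
  iid_law D P X -> (forall x, D [set x] = 0%E) -> measurable_fun setT f ->
  depends_on (predC1 i) f ->
  P [set w | X i w = f (X ^~ w)] = 0%E.
Proof.
move=> iidX D0 mf df.
have mS : measurable [set v : vecs I | v i = f v].
  exact: measurable_set_eq (measurable_coord i) mf.
have iidM := iid_law_mix (predC1 i) iidX.
have := @iid_law_transfer R D _ _ P _ _ (P \x P)%E I X
  (mix (predC1 i) X) iidX iidM _ mS.
move=> /= ->.
rewrite /product_measure1 integral0_eq// => w1 _ /=.
rewrite (_ : xsection _ _ = X i @^-1` [set f (X ^~ w1)]).
  by rewrite (iid_law_marginal _ iidX)//; exact: D0.
apply/seteqP; split=> w2; rewrite /xsection/= in_setE/= /mix/= eqxx/= => ->;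
  by apply: df => j /= /negPf ji; rewrite ji.
Qed.

End Independence.

(** * Real-valued probabilities *)

Section RealProbability.
Set Implicit Arguments.
Unset Strict Implicit.
Context {R : realType} {d} {T : measurableType d} (P : probability T R).

Definition pr (A : set T) : R := fine (P A).

Lemma prE (A : set T) : measurable A -> P A = (pr A)%:E.
Proof. by move=> mA; rewrite /pr fineK// fin_num_measure. Qed.

Lemma pr_ge0 (A : set T) : 0 <= pr A.
Proof. exact: fine_ge0. Qed.

Lemma le_pr (A B : set T) : measurable A -> measurable B -> A `<=` B ->
  pr A <= pr B.
Proof. by move=> mA mB AB; rewrite -lee_fin -!prE// le_measure ?in_setE. Qed.

Lemma pr_le1 (A : set T) : measurable A -> pr A <= 1.
Proof. by move=> mA; rewrite -lee_fin -prE// probability_le1. Qed.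

Lemma pr_setD (A B : set T) : measurable A -> measurable B -> A `<=` B ->
  pr (B `\` A) = pr B - pr A.
Proof.
move=> mA mB AB; have mD := measurableD mB mA.
apply/eqP; rewrite eq_sym subr_eq -eqe EFinD -!prE//; apply/eqP.
rewrite -measureU//; first by rewrite setUC setDUK.
by rewrite setIC; apply/seteqP; split => x //= -[? []].
Qed.

Lemma pr_sum_disjoint (I : finType) (Q : pred I) (A : I -> set T) (B : set T) :
  (forall i, measurable (A i)) -> measurable B -> (forall i, Q i -> A i `<=` B) ->
  (forall i j w, Q i -> Q j -> A i w -> A j w -> i = j) ->
  \sum_(i | Q i) pr (A i) <= pr B.
Proof.
move=> mA mB AB dA.
rewrite -lee_fin -prE// -sumEFin; under eq_bigr do rewrite -prE//.
rewrite -big_filter fsbig_seq ?filter_uniq ?index_enum_uniq//.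
rewrite -measure_fin_bigcup//; last first.
  by move=> i j /=; rewrite !mem_filter => /andP[Qi _] /andP[Qj _] [w [? ?]];
    apply: (dA i j w).
apply: le_measure; rewrite ?in_setE//; last first.
  by move=> w [i /=]; rewrite mem_filter => /andP[Qi _]; exact: AB.
by apply: fin_bigcup_measurable => //; exact: finite_seq.
Qed.

Lemma pr_le_sum (I : finType) (A : I -> set T) (B : set T) :
  (forall i, measurable (A i)) -> measurable B ->
  (forall w, B w -> exists i, A i w) ->
  pr B <= \sum_i pr (A i).
Proof.
move=> mA mB BA.
rewrite -lee_fin -prE// -sumEFin; under eq_bigr do rewrite -prE//.
rewrite fsbig_seq ?index_enum_uniq//; apply: content_sub_fsum => //.
by move=> w /BA[i Ai]; exists i => //=; rewrite mem_index_enum.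
Qed.

End RealProbability.

(** * Exchangeability and the maximum of an iid family *)

Section TopOfIidFamily.
Set Implicit Arguments.
Unset Strict Implicit.
Context {R : realType} {d} {T : measurableType d} (P : probability T R).
Variables (D : set R -> \bar R) (k : nat) (Y : 'I_k -> T -> R).
Hypothesis iidY : iid_law D P Y.

Definition top (s : 'I_k) := [set w | forall j, Y j w <= Y s w].

Definition near_top (eps : R) (s l : 'I_k) :=
  top s `&` [set w | Y s w < Y l w + eps].

Let mY i : measurable_fun setT (Y i). Proof. by case: iidY. Qed.

Lemma measurable_top s : measurable (top s).
Proof. by apply: measurable_forall => j; exact: measurable_set_le. Qed.

Lemma measurable_near_top eps s l : measurable (near_top eps s l).
Proof.
apply: measurableI; first exact: measurable_top.
by apply: measurable_set_lt => //; exact: measurable_funD.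
Qed.

Lemma pr_perm (sg : {perm 'I_k}) (S : set (@vecs R 'I_k)) : measurable S ->
  pr P [set w | S (Y ^~ w)] = pr P [set w | S (fun j => Y (sg j) w)].
Proof.
move=> mS; congr fine.
exact: iid_law_transfer iidY (iid_law_reindex (@perm_inj _ sg) iidY) S mS.
Qed.

(** Strict-maximum events are disjoint and, by exchangeability, equally likely, so each has
    probability at most 1/k; ties are null. *)
Lemma pr_top_le s : (forall x, D [set x] = 0%E) -> pr P (top s) <= k%:R^-1.
Proof.
move=> D0; have k0 : (0 < k)%N by case: k s => // -[].
pose G s := [set w | forall j, j != s -> Y j w < Y s w].
pose S s : set (@vecs R 'I_k) := [set v | forall j, j != s -> v j < v s].
have mS s' : measurable (S s').
  rewrite (_ : S s' = [set v : @vecs R 'I_k |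
      forall j, (if j != s' then [set v : @vecs R 'I_k | v j < v s'] else setT) v]).
    apply: measurable_forall => j; case: ifP => // _.
    by apply: measurable_set_lt; exact: measurable_coord.
  by apply/seteqP; split=> v /= h j; have := h j; case: ifP => //= _; exact.
have mG s' : measurable (G s') := measurable_vector_event iidY (mS s').
have GG s' : pr P (G s') = pr P (G s).
  rewrite [RHS](pr_perm (tperm s s') (mS s)); congr pr.
  apply/seteqP; split=> w /= h j js.
    rewrite tpermL; apply: h.
    by rewrite -(inj_eq (@perm_inj _ (tperm s s'))) tpermK tpermR.
  have := h (tperm s s' j); rewrite tpermK tpermL; apply.
  by rewrite -(inj_eq (@perm_inj _ (tperm s s'))) tpermK tpermL.
have Gle : pr P (G s) <= k%:R^-1.
  have : \sum_i pr P (G i) <= pr P setT.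
    apply: pr_sum_disjoint => // i j w _ _ Gi Gj; apply/eqP/negPn/negP => ij.
    by have := lt_trans (Gi _ (contra_neq esym ij)) (Gj _ ij); rewrite ltxx.
  under eq_bigr do rewrite GG.
  rewrite sumr_const card_ord /pr probability_setT/= => h.
  by rewrite -[_^-1]mul1r ler_pdivlMr ?ltr0n// mulr_natr.
apply: le_trans Gle.
(* The weak maximum event is covered by the strict one, stored at index [s], and the null ties with
   the other indices. *)
pose tie j := if j == s then G s else [set w | Y j w = Y s w].
have -> : pr P (G s) = \sum_j pr P (tie j).
  rewrite (bigD1 s)//= big1 ?addr0 /tie ?eqxx// => j js; rewrite (negPf js).
  have /= := @iid_law_tie R D _ _ P _ Y j (fun v => v s) iidY D0.
  rewrite /pr => ->//; first exact: measurable_coord.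
  by move=> v v' vv'; apply: vv'; rewrite /= eq_sym.
apply: pr_le_sum.
- by move=> j; rewrite /tie; case: ifP => // _; exact: measurable_set_eq.
- exact: measurable_top.
- move=> w tw; have [[j js e]|h] := pselect (exists2 j, j != s & Y j w = Y s w).
    by exists j; rewrite /tie (negPf js).
  exists s; rewrite /tie eqxx => j js; rewrite lt_neqAle tw andbT.
  by apply/eqP => e; apply: h; exists j.
Qed.

(** Some permutation carries any ordered pair of distinct indices to any other. *)
Lemma pr_near_top_sym eps s l s' l' : s != l -> s' != l' ->
  pr P (near_top eps s l) = pr P (near_top eps s' l').
Proof.
move=> sl sl'.
pose S : set (@vecs R 'I_k) :=
  [set v | forall j, v j <= v s] `&` [set v | v s < v l + eps].
have mS : measurable S.
  apply: measurableI.
    by apply: measurable_forall => j; apply: measurable_set_le;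
      exact: measurable_coord.
  apply: measurable_set_lt; first exact: measurable_coord.
  by apply: measurable_funD => //; exact: measurable_coord.
(* The first transposition sends [s] to [s']; the second moves the image of [l] to [l'] and fixes
   [s']. *)
pose sg := (tperm s s' * tperm (tperm s s' l) l')%g.
have sgs : sg s = s'.
  rewrite /sg permM tpermL tpermD//; last by rewrite eq_sym.
  by rewrite -{2}(tpermL s s') (inj_eq perm_inj) eq_sym.
have sgl : sg l = l' by rewrite /sg permM tpermL.
have := pr_perm sg mS.
rewrite (_ : [set w | S (Y ^~ w)] = near_top eps s l)// => ->; congr pr.
apply/seteqP; split=> w /=; rewrite /S/= sgs sgl => -[h ?]; split=> // j.
by rewrite -(permKV sg j).
Qed.

End TopOfIidFamily.

(** * Lower bound for the probability of a small gap at the maximum *)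

Section GapAtTheTop.
Set Implicit Arguments.
Unset Strict Implicit.
Context {R : realType}.

(** Cauchy-Schwarz through the tangent bound [p ^+ 2 >= 2 * a * p - a ^+ 2] at [a = 1 / (4 * N)]:
    over at most [N] indices the sum is at least [1 / (8 * N) - 1 / (16 * N)]. *)
Lemma sum_sqr_ge (N : nat) (Q : pred 'I_N) (p : 'I_N -> R) : (0 < N)%N ->
  4^-1 <= \sum_(b | Q b) p b -> (16 * N%:R)^-1 <= \sum_(b | Q b) p b ^+ 2.
Proof.
move=> N0 h; have N1 : 0 < N%:R :> R by rewrite ltr0n.
pose a : R := (4 * N%:R)^-1.
have : \sum_(b | Q b) (2 * a * p b - a ^+ 2) <= \sum_(b | Q b) p b ^+ 2.
  by apply: ler_sum => b _; rewrite -subr_ge0; have := sqr_ge0 (p b - a); lra.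
apply: le_trans; rewrite sumrB -mulr_sumr.
have : \sum_(b | Q b) a ^+ 2 <= N%:R * a ^+ 2.
  rewrite sumr_const -[leLHS]mulr_natl ler_wpM2r ?sqr_ge0// ler_nat.
  by rewrite (leq_trans (max_card _))// card_ord.
have a0 : 0 < a by rewrite invr_gt0 mulr_gt0.
have -> : (16 * N%:R)^-1 = 2 * a * 4^-1 - N%:R * a ^+ 2.
  by rewrite /a; field; rewrite lt0r_neq0.
by move: (\sum_(b | Q b) a ^+ 2) (\sum_(b | Q b) p b) h => x y; nra.
Qed.

Context {d} {T : measurableType d} (P : probability T R).
Variables (D : set R -> \bar R) (k : nat) (Y : 'I_k -> T -> R).
Hypothesis iidY : iid_law D P Y.

(* With probability of order [1/N] two of the variables fall in a common bin
   above the median while all the others stay below its right end; then the two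
   largest values differ by less than [eps]. *)
Lemma pr_near_top_ge (s l : 'I_k) (lo eps : R) (N : nat) :
  s != l -> 0 < eps -> (0 < N)%N ->
  3 / 4 <= pr P [set w | lo <= Y s w < lo + N%:R * eps] ->
  2^-1 ^+ k / (16 * N%:R * k%:R ^+ 2) <= pr P (near_top Y eps s l).
Proof.
move=> sl eps0 N0 window.
have mY i : measurable_fun setT (Y i) by case: iidY.
pose edge (b : nat) := lo + b%:R * eps.
have le_edge a b : (a <= b)%N -> edge a <= edge b.
  by move=> ab; rewrite lerD2l ler_wpM2r ?ler_nat// ltW.
pose bin b := `[edge b, edge b.+1[%classic.
pose ray b := `]-oo, edge b[%classic.
pose mu B := pr P (Y s @^-1` B).
have mpre i B : measurable B -> measurable (Y i @^-1` B).
  by move=> mB; rewrite -[X in measurable X]setTI; exact: mY.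
have muE i B : measurable B -> pr P (Y i @^-1` B) = mu B.
  by move=> mB; rewrite /mu /pr !(iid_law_marginal _ iidY).
have le_mu A B : measurable A -> measurable B -> A `<=` B -> mu A <= mu B.
  move=> mA mB AB; apply: le_pr; [exact: mpre|exact: mpre|].
  by move=> w; exact: AB.
have mbin b : measurable (bin b) by exact: measurable_itv.
have mray b : measurable (ray b) by exact: measurable_itv.
have mwin : measurable [set w | lo <= Y s w < lo + N%:R * eps].
  rewrite (_ : mkset _ = Y s @^-1` `[lo, lo + N%:R * eps[%classic).
    by apply: mpre; exact: measurable_itv.
  by apply/seteqP; split=> w /=; rewrite in_itv.
have exb : exists b, 2^-1 <= mu (ray b.+1).
  exists N.-1; rewrite prednK//; apply: (@le_trans _ _ (3 / 4)); first by lra.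
  apply: (le_trans window); apply: le_pr.
  - exact: mwin.
  - exact: mpre.
  - by move=> w /= /andP[_]; rewrite /ray/= in_itv.
(* [b0] is the first bin whose right end has at least half of the mass to its left. *)
pose b0 := ex_minn exb.
have [b0half b0min] : 2^-1 <= mu (ray b0.+1) /\
    forall b, 2^-1 <= mu (ray b.+1) -> (b0 <= b)%N.
  by rewrite /b0; case: ex_minnP.
have below : (0 < b0)%N -> mu (ray b0) <= 2^-1.
  move=> b00; rewrite leNgt; apply/negP => /ltW.
  by rewrite -(prednK b00) => /b0min; rewrite leqNgt ltn_predL b00.
(* Of the mass 3/4 in the window, at most 1/2 lies to the left of bin [b0]. *)
have mass : 4^-1 <= \sum_(b < N | (b0 <= b)%N) mu (bin b).
  pose A (b : option 'I_N) := match b with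
    | Some b => if (b0 <= b)%N then Y s @^-1` bin b else set0
    | None => if (0 < b0)%N then Y s @^-1` ray b0 else set0 end.
  have /(le_trans window) : pr P [set w | lo <= Y s w < lo + N%:R * eps] <=
      \sum_b pr P (A b).
    apply: pr_le_sum.
    - by move=> [b|] /=; case: ifP => _ //; exact: mpre.
    - exact: mwin.
    - move=> w /= /andP[w1 w2].
      have exc : exists b, Y s w < edge b.+1.
        by exists N.-1; rewrite prednK.
      case: (ex_minnP exc) => b wb bmin.
      have bN : (b < N)%N by rewrite -(prednK N0) ltnS bmin// prednK.
      have wb' : edge b <= Y s w.
        case: b wb bmin {bN} => [|b] wb bmin; first by rewrite /edge mul0r addr0.
        by rewrite leNgt; apply/negP => /bmin; rewrite ltnn.
      have [b0b|bb0] := leqP b0 b.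
        by exists (Some (Ordinal bN)); rewrite /A/= b0b /bin/= in_itv/= wb' wb.
      exists None; rewrite /A (leq_ltn_trans (leq0n b) bb0) /ray/= in_itv/=.
      exact: lt_le_trans wb (le_edge _ _ bb0).
  rewrite (bigD1 None)//= (reindex_omap Some id)/=; last by case.
  rewrite [X in _ + X](_ : _ = \sum_(b < N | (b0 <= b)%N) mu (bin b)); last first.
    rewrite [RHS]big_mkcond/=; apply: eq_big => [b|b _]; first by rewrite eqxx.
    by case: ifP => // _; rewrite /pr measure0.
  have : pr P (if (0 < b0)%N then Y s @^-1` ray b0 else set0) <= 2^-1.
    by case: ifPn => [/below//|_]; rewrite /pr measure0 invr_ge0.
  lra.
have mu0 B : 0 <= mu B by exact: pr_ge0.
(* [Y s] and [Y l] must fall in bin [b]; each other variable only has to stay below its right end,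
   which has probability at least 1/2 once [b0 <= b]. *)
pose B b i := if (i == s) || (i == l) then bin b else ray b.+1.
have mB b i : measurable (B b i) by rewrite /B; case: ifP.
pose A (b : 'I_N) := [set w | forall i, B b i (Y i w)].
have mA b : measurable (A b).
  by apply: measurable_forall => i; exact: mpre.
have prA (b : 'I_N) : (b0 <= b)%N -> 2^-1 ^+ k * mu (bin b) ^+ 2 <= pr P (A b).
  move=> b0b.
  have -> : pr P (A b) = \prod_i mu (B b i).
    apply: EFin_inj; rewrite -prE//.
    have [_ _ ->//] := iidY; rewrite -prodEFin; apply: eq_bigr => i _.
    by rewrite -(muE i)// -prE ?(iid_law_marginal _ iidY)//; exact: mpre.
  rewrite (bigD1 s)//= (bigD1 l)/=; last by rewrite eq_sym.
  rewrite {1 2}/B !eqxx orbT/= mulrA -expr2 mulrC ler_wpM2l ?sqr_ge0//.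
  apply: (@le_trans _ _ (\prod_(i < k | (i != s) && (i != l)) 2^-1)).
    rewrite prodr_const; apply: ler_wiXn2l; rewrite ?invr_ge0 ?invf_le1 ?ler1n//.
    by rewrite -[leqRHS]card_ord max_card.
  apply: ler_prod => i /andP[/negPf is_ /negPf il]; rewrite invr_ge0 ler0n/=.
  rewrite /B is_ il/=; apply: (le_trans b0half); apply: le_mu => //.
  by apply: subset_itvl; rewrite bnd_simp le_edge.
pose G (p : 'I_k * 'I_k) := if p.1 == p.2 then set0 else near_top Y eps p.1 p.2.
have mG p : measurable (G p).
  by rewrite /G; case: ifP => // _; exact: measurable_near_top iidY _ _ _.
pose Gam := \bigcup_(p in [set: 'I_k * 'I_k]) G p.
have mGam : measurable Gam.
  by apply: fin_bigcup_measurable => //; exact: finite_finset.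
have upper : pr P Gam <= k%:R ^+ 2 * pr P (near_top Y eps s l).
  apply: (@le_trans _ _ (\sum_p pr P (G p))).
    by apply: pr_le_sum => // w [p _ Gp]; exists p.
  apply: (@le_trans _ _ (\sum_(p : 'I_k * 'I_k) pr P (near_top Y eps s l))).
    apply: ler_sum => p _; rewrite /G; case: ifPn => [_|p12].
      by rewrite {1}/pr measure0 pr_ge0.
    by rewrite (pr_near_top_sym iidY eps p12 sl).
  by rewrite sumr_const card_prod card_ord -[leLHS]mulr_natl natrM expr2.
have lower : \sum_(b < N | (b0 <= b)%N) pr P (A b) <= pr P Gam.
  apply: pr_sum_disjoint => //.
  - move=> b b0b w Aw.
    have /= := @Order.TotalTheory.arg_maxP _ _ _ s xpredT (Y ^~ w) isT.
    case=> s' _ s'max.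
    have hi : Y s' w < edge b.+1.
      have := Aw s'; rewrite /B /bin /ray.
      by case: ifP => _ /=; rewrite in_itv//= => /andP[].
    (* Whichever index [s'] is on top, one of [s] and [l] differs from it and has its variable in
       bin [b]. *)
    pose l' := if s' == s then l else s.
    have lo' : edge b <= Y l' w.
      have := Aw l'; rewrite /B ifT; first by rewrite /bin/= in_itv/= => /andP[].
      by rewrite /l'; case: ifP => _; rewrite eqxx ?orbT.
    have sl' : s' != l' by rewrite /l'; case: (eqVneq s' s) => [->|].
    exists (s', l') => //; rewrite /G /= (negPf sl'); split=> /=.
      by move=> j; exact: s'max.
    apply: (lt_le_trans hi); apply: le_trans (_ : edge b + eps <= _).
      by rewrite /edge -natr1; lra.
    by rewrite lerD2r.
  - have dis (b c : 'I_N) w : A b w -> A c w -> ~ (b < c)%N.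
      move=> Ab Ac bc; have := Ab s; have := Ac s; rewrite /B eqxx /bin/= !in_itv/=.
      move=> /andP[h1 _] /andP[_ h2].
      by have := le_lt_trans (le_trans (le_edge _ _ bc) h1) h2; rewrite ltxx.
    move=> b c w _ _ Ab Ac; apply/val_inj/eqP.
    rewrite eqn_leq leqNgt [X in _ && X]leqNgt.
    by apply/andP; split; apply/negP; [exact: dis Ac Ab|exact: dis Ab Ac].
have sq := sum_sqr_ge N0 mass.
have k0 : (0 < k)%N by exact: leq_ltn_trans (leq0n s) (ltn_ord s).
rewrite invfM mulrA ler_pdivrMr ?exprn_gt0 ?ltr0n// [leRHS]mulrC.
apply: le_trans upper; apply: le_trans lower.
apply: (@le_trans _ _ (\sum_(b < N | (b0 <= b)%N) 2^-1 ^+ k * mu (bin b) ^+ 2)).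
  by rewrite -mulr_sumr ler_wpM2l// exprn_ge0 ?invr_ge0.
by apply: ler_sum => b; exact: prA.
Qed.

End GapAtTheTop.

(** * Variance bound and concentration window for sums *)

Section SecondMoment.
Set Implicit Arguments.
Unset Strict Implicit.
Context {R : realType}.

Lemma iid_law_integral (D : set R -> \bar R) d1 (T1 : measurableType d1)
    (P1 : probability T1 R) d2 (T2 : measurableType d2)
    (P2 : probability T2 R) (I : finType) (X1 : I -> T1 -> R)
    (X2 : I -> T2 -> R) (h : @vecs R I -> R) :
  iid_law D P1 X1 -> iid_law D P2 X2 -> measurable_fun setT h ->
  (forall v, 0 <= h v) ->
  (\int[P1]_w (h (X1 ^~ w))%:E = \int[P2]_w (h (X2 ^~ w))%:E)%E.
Proof.
move=> iid1 iid2 mh h0.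
have [_ mX1 _] := iid1; have [_ mX2 _] := iid2.
have mV1 := measurable_vector mX1; have mV2 := measurable_vector mX2.
pose X1' : {mfun T1 >-> @vecs R I} := HB.pack (fun w => X1 ^~ w : @vecs R I)
  (isMeasurableFun.Build _ _ _ _ _ mV1).
pose X2' : {mfun T2 >-> @vecs R I} := HB.pack (fun w => X2 ^~ w : @vecs R I)
  (isMeasurableFun.Build _ _ _ _ _ mV2).
have mEh : measurable_fun setT (EFin \o h) by exact/measurable_EFinP.
have Eh0 v : (0 <= (EFin \o h) v)%E by rewrite lee_fin.
rewrite -[LHS](@ge0_integral_distribution _ _ _ _ _ P1 X1' _ mEh Eh0).
rewrite -[RHS](@ge0_integral_distribution _ _ _ _ _ P2 X2' _ mEh Eh0).
by apply: eq_measure_integral => S mS _; exact: iid_law_transfer iid1 iid2 S mS.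
Qed.

Context {d} {T : measurableType d} (P : probability T R).

Lemma bounded_integrable (X : T -> R) (a b : R) :
  measurable_fun setT X -> (forall w, a <= X w <= b) ->
  P.-integrable setT (EFin \o X).
Proof.
move=> mX Xab; apply: (@measurable_bounded_integrable _ _ _ P).
- exact: measurableT.
- by rewrite -ge0_fin_numE// fin_num_measure.
- exact: mX.
- exists (`|a| + `|b|); split; first exact: num_real.
  move=> x xab w _ /=; apply: (le_trans _ (ltW xab)).
  have /andP[aX Xb] := Xab w.
  rewrite ler_norml; apply/andP; split.
    by apply: le_trans aX; rewrite lerNl; have := ler_norm (- a);
      rewrite normrN; have := normr_ge0 b; lra.
  by apply: (le_trans Xb); have := ler_norm b; have := normr_ge0 a; lra.
Qed.

(** The cross term integrates to zero and [(X w - mu) ^+ 2 <= 1] pointwise; [ub] combines both into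
    a bound affine in [X w]. *)
Lemma integral_shift_sqr (X : T -> R) (s : R) :
  measurable_fun setT X -> (forall w, 0 <= X w <= 1) ->
  (\int[P]_w ((s + (X w - fine (\int[P]_w' (X w')%:E))) ^+ 2)%:E
   <= (s ^+ 2 + 1)%:E)%E.
Proof.
move=> mX X01; set mu := fine _.
have iX := bounded_integrable mX X01.
have muE : (\int[P]_w (X w)%:E = mu%:E)%E.
  by rewrite /mu fineK//; exact: integrable_fin_num.
have mu0 : 0 <= mu.
  rewrite -lee_fin -muE; apply: integral_ge0 => w _.
  by rewrite lee_fin; case/andP: (X01 w).
have mu1 : mu <= 1.
  rewrite -lee_fin -muE; have -> : 1%:E = (\int[P]_w (1%R)%:E)%E.
    by rewrite integral_cst//= probability_setT mule1.
  apply: ge0_le_integral => //.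
  - by move=> w _; rewrite lee_fin; case/andP: (X01 w).
  - exact/measurable_EFinP.
  - by move=> w _; rewrite lee_fin; case/andP: (X01 w).
pose c : R := s ^+ 2 + 1 - 2 * s * mu.
have ub w : (s + (X w - mu)) ^+ 2 <= c + 2 * s * X w.
  by rewrite /c; have /andP[? ?] := X01 w; nra.
have mlin : measurable_fun setT (fun w => c + 2 * s * X w).
  by apply: measurable_funD => //; exact: measurable_funM.
apply: (@le_trans _ _ (\int[P]_w (c + 2 * s * X w)%:E)%E).
  apply: ge0_le_integral => //.
  - by move=> w _; rewrite lee_fin sqr_ge0.
  - apply/measurable_EFinP; apply: measurable_funX; apply: measurable_funD => //.
    exact: measurable_funB.
  - exact/measurable_EFinP.
  - by move=> w _; rewrite lee_fin.
have -> : (\int[P]_w (c + 2 * s * X w)%:E =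
    \int[P]_w (c%:E + (2 * s)%:E * (X w)%:E))%E by [].
rewrite integralD//; last 2 first.
- by apply: (@bounded_integrable (cst c) c c) => // w; rewrite lexx.
- exact: integrableZl.
rewrite integral_cst//= probability_setT mule1 integralZl// muE.
by rewrite -EFinM -EFinD lee_fin /c subrK.
Qed.

Variables (D : set R -> \bar R) (I : finType) (X : I -> T -> R).
Hypothesis iidX : iid_law D P X.
Hypothesis X01 : forall i w, 0 <= X i w <= 1.

Let mean i := fine (\int[P]_w (X i w)%:E).

(** Induction replaces the expansion into covariances: the new variable is read in a second copy and
    integrated first, with the partial sum as a constant shift, and adds at most 1. *)
Lemma integral_centred_sum_sqr (s : seq I) : uniq s ->
  (\int[P]_w ((\sum_(i <- s) (X i w - mean i)) ^+ 2)%:E <= (size s)%:R%:E)%E.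
Proof.
have mX i : measurable_fun setT (X i) by case: iidX.
elim: s => [_|i s IH /= /andP[is_ us]].
  under eq_integral do rewrite big_nil expr0n.
  by rewrite integral0.
pose h (v : @vecs R I) := (\sum_(j <- i :: s) (v j - mean j)) ^+ 2.
have mh : measurable_fun setT h.
  apply: measurable_funX; apply: measurable_sum => j.
  by apply: measurable_funB => //; exact: measurable_coord.
have h0 v : 0 <= h v by exact: sqr_ge0.
have iidM := iid_law_mix (predC1 i) iidX.
have := @iid_law_integral D _ _ P _ _ (P \x P)%E I X _ h iidX iidM mh h0.
rewrite {1}/h => ->.
pose S w := \sum_(j <- s) (X j w - mean j).
have hE w : h (mix (predC1 i) X ^~ w) = (S w.1 + (X i w.2 - mean i)) ^+ 2.
  rewrite /h big_cons {1}/mix/= eqxx/= addrC; congr ((_ + _) ^+ 2).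
  rewrite /S big_seq [RHS]big_seq; apply: eq_bigr => j js.
  by rewrite /mix/= ifT//; apply: contraNneq is_ => <-.
under eq_integral do rewrite hE.
have mS : measurable_fun setT S.
  by apply: measurable_sum => j; exact: measurable_funB.
pose F (w : T * T) := ((S w.1 + (X i w.2 - mean i)) ^+ 2)%:E.
rewrite (@fubini_tonelli1 _ _ _ _ _ P P F); last 2 first.
- apply/measurable_EFinP; apply: measurable_funX; apply: measurable_funD.
    by apply: measurableT_comp.
  by apply: measurable_funB => //; apply: measurableT_comp.
- by move=> w; rewrite /F lee_fin sqr_ge0.
apply: (@le_trans _ _ (\int[P]_w ((S w ^+ 2)%:E + 1%:E))%E).
  apply: ge0_le_integral => //.
  - by move=> w _; apply: integral_ge0 => w' _; rewrite /F lee_fin sqr_ge0.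
  - apply: measurable_fun_fubini_tonelli_F => //; last first.
      by move=> w; rewrite /F lee_fin sqr_ge0.
    apply/measurable_EFinP; apply: measurable_funX; apply: measurable_funD.
      by apply: measurableT_comp.
    by apply: measurable_funB => //; apply: measurableT_comp.
  - apply: emeasurable_funD => //; apply/measurable_EFinP.
    exact: measurable_funX.
  - by move=> w _; rewrite -EFinD; exact: integral_shift_sqr (S w) (mX i) (X01 i).
rewrite ge0_integralD//; last 2 first.
- by move=> w _; rewrite lee_fin sqr_ge0.
- by apply/measurable_EFinP; exact: measurable_funX.
rewrite integral_cst//= probability_setT mule1 -natr1 EFinD leeD2r//.
exact: IH.
Qed.

(** Chebyshev's inequality with radius [2 * sqrt (size s)] about the mean: the variance is at most
    [size s], so at most 1/4 of the mass is lost. *)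
Lemma sum_window (s : seq I) : uniq s -> (0 < size s)%N ->
  exists lo, forall b, 4 * Num.sqrt (size s)%:R <= b ->
    3 / 4 <= pr P [set w | lo <= \sum_(i <- s) X i w < lo + b].
Proof.
move=> us s0.
have mX i : measurable_fun setT (X i) by case: iidX.
have t0 : 0 < (size s)%:R :> R by rewrite ltr0n.
pose L : R := 2 * Num.sqrt (size s)%:R.
have L0 : 0 < L by rewrite mulr_gt0 ?sqrtr_gt0.
have L2 : L ^+ 2 = 4 * (size s)%:R.
  by rewrite /L exprMn sqr_sqrtr ?ler0n//; congr (_ * _); rewrite -natrX.
pose S w := \sum_(i <- s) (X i w - mean i).
pose c := \sum_(i <- s) mean i.
have SE w : \sum_(i <- s) X i w = S w + c by rewrite /S sumrB subrK.
have mS : measurable_fun setT S.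
  by apply: measurable_sum => j; exact: measurable_funB.
exists (c - L) => b Lb.
pose far := [set w | L ^+ 2 <= S w ^+ 2].
have mfar : measurable far.
  by apply: measurable_set_le => //; exact: measurable_funX.
have prfar : pr P far <= 4^-1.
  have := integral_centred_sum_sqr us.
  have := @le_integral_abse _ _ _ P setT measurableT
    (fun w => (S w ^+ 2)%:E) (L ^+ 2).
  rewrite setTI (_ : [set w | _] = far); last first.
    by apply/seteqP; split=> w /=; rewrite lee_fin ger0_norm ?sqr_ge0.
  move=> /(_ _ _)/le_trans h1 h2.
  have : ((L ^+ 2)%:E * P far <= (size s)%:R%:E)%E.
    apply: h1; last first.
    - by under eq_integral do rewrite gee0_abs ?lee_fin ?sqr_ge0//.
    - by rewrite exprn_gt0.
    - by apply/measurable_EFinP; exact: measurable_funX.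
  rewrite prE// -EFinM lee_fin L2.
  by rewrite -mulrA -ler_pdivlMl// mulrC; nra.
apply: (@le_trans _ _ (1 - pr P far)); first lra.
have -> : 1 = pr P setT by rewrite /pr probability_setT.
rewrite -pr_setD//; apply: le_pr.
- exact: measurableD.
- rewrite (_ : mkset _ = [set w | c - L <= \sum_(i <- s) X i w] `&`
      [set w | \sum_(i <- s) X i w < c - L + b]); last first.
    by apply/seteqP; split=> w /=; [move=> /andP[]|move=> [-> ->]].
  have mZ : measurable_fun setT (fun w => \sum_(i <- s) X i w).
    exact: measurable_sum.
  by apply: measurableI; [exact: measurable_set_le|exact: measurable_set_lt].
- move=> w [_ /negP]; rewrite -ltNge/= SE => SL.
  have : `|S w| < L.
    rewrite -(ltr_pXn2r (n := 2))// ?nnegrE ?normr_ge0 1?ltW//.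
    by rewrite real_normK ?num_real.
  rewrite ltr_norml => /andP[h1 h2].
  have : 2 * L <= b by rewrite /L mulrA -natrM.
  by move=> h3; apply/andP; split; lra.
Qed.

End SecondMoment.

(** * Sums over disjoint blocks *)

Section BlockSums.
Set Implicit Arguments.
Unset Strict Implicit.
Context {R : realType} {d} {T : measurableType d} (P : probability T R).
Variables (D : set R -> \bar R) (K H : finType) (X : K * H -> T -> R).
Hypothesis iidX : iid_law D P X.

Definition block_sum (j : K) (w : T) : R := \sum_h X (j, h) w.

Let mX i : measurable_fun setT (X i). Proof. by case: iidX. Qed.

Lemma measurable_block_sum j : measurable_fun setT (block_sum j).
Proof. exact: measurable_sum. Qed.

Let bs j (v : @vecs R (K * H)%type) : R := \sum_h v (j, h).

Let measurable_bs j : measurable_fun setT (bs j).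
Proof. by apply: measurable_sum => h; exact: measurable_coord. Qed.

(** Disjoint blocks give independence, and exchanging block [j] with block [j0] gives equality of
    laws. *)
Lemma block_sum_iid (j0 : K) :
  iid_law (fun B => P (block_sum j0 @^-1` B)) P block_sum.
Proof.
split; first by rewrite preimage_setT probability_setT.
  exact: measurable_block_sum.
move=> B mB.
pose S j : set (@vecs R (K * H)%type) := bs j @^-1` B j.
have mS j : measurable (S j).
  by rewrite -[X in measurable X]setTI; exact: measurable_bs.
have -> : [set w | forall j, B j (block_sum j w)] =
    [set w | forall j, j \in [set: K]%SET -> S j (X ^~ w)].
  by apply/seteqP; split=> w /= h j; [move=> _; exact: h|exact: h].
rewrite (iid_law_indep_blocks (blk := fst) _ iidX mS); last first.
  move=> j v v' vv'; apply/propext; rewrite /S/= /bs.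
  by rewrite (eq_bigr (fun h => v' (j, h)))// => h _; rewrite vv'/=.
apply: eq_big => [j|j _]; first by rewrite inE.
pose f (p : K * H) := (tperm j j0 p.1, p.2).
have finj : injective f by move=> [a b] [a' b'] [/perm_inj -> ->].
have := iid_law_transfer iidX (iid_law_reindex finj iidX) (mS j).
by rewrite /S /bs /f/= tpermL.
Qed.

(** Singling out one summand turns hitting [x] into a tie between it and a function of the other
    coordinates. *)
Lemma block_sum_atomless j x : (forall y, D [set y] = 0%E) -> (0 < #|H|)%N ->
  P (block_sum j @^-1` [set x]) = 0%E.
Proof.
move=> D0 /card_gt0P[h0 _].
pose f (v : @vecs R (K * H)%type) := 
  x - \sum_(h <- [seq h <- index_enum H | h != h0]) v (j, h).
have := @iid_law_tie R D _ _ P _ X (j, h0) f iidX D0.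
rewrite (_ : [set w | _] = block_sum j @^-1` [set x]).
  apply; first apply: measurable_funB => //.
    by apply: measurable_sum => h; exact: measurable_coord.
  move=> v v' vv'; rewrite /f !big_filter; congr (x - _).
  by apply: eq_bigr => h hh0; apply: vv'; rewrite /= xpair_eqE eqxx.
have e w : block_sum j w = X (j, h0) w +
    \sum_(h <- [seq h <- index_enum H | h != h0]) X (j, h) w.
  by rewrite big_filter /block_sum (bigD1 h0).
apply/seteqP; split=> w /=; rewrite /f e; first by move=> ->; rewrite subrK.
by move=> <-; rewrite addrK.
Qed.

End BlockSums.

(** * Equal bundles with one extra good *)

Section EqualBundlesPlusOne.
Set Implicit Arguments.
Unset Strict Implicit.
Context {R : realType} {d} {T : measurableType d} (P : probability T R).

(** The coefficient of [1 / sqrt t] in the gain: the bound [2^-1 ^+ k / (16 * N * k ^ 2)] for a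
    near-top event with [N <= (4 / eps + 1) * sqrt t] bins, times 1/2 for an extra good worth at
    least [eps]. *)
Definition margin (k : nat) (eps : R) : R :=
  2^-1 ^+ k.+1 / (16 * k%:R ^+ 2 * (4 / eps + 1)).

Lemma margin_gt0 k eps : (0 < k)%N -> 0 < eps -> 0 < margin k eps.
Proof.
move=> k0 eps0; rewrite divr_gt0 ?exprn_gt0 ?invr_gt0//.
rewrite mulr_gt0 ?mulr_gt0 ?exprn_gt0 ?ltr0n// ltr_wpDl//.
by rewrite divr_ge0// ltW.
Qed.

(** Keeps [1/k - margin k eps / sqrt m] nonnegative for [m >= 1], as the case of an empty smallest
    bundle requires. *)
Lemma margin_le k eps : (0 < k)%N -> 0 < eps -> margin k eps <= k%:R^-1.
Proof.
move=> k0 eps0; have k1 : 1 <= k%:R :> R by rewrite ler1n.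
have e1 : 1 <= 4 / eps + 1 by rewrite lerDr divr_ge0// ltW.
have a1 : 2^-1 ^+ k.+1 <= 1 :> R.
  by rewrite exprn_ile1 ?invr_ge0// invf_le1 ?ler1n.
rewrite /margin ler_pdivrMr; last by rewrite !mulr_gt0//; nra.
apply: (le_trans a1).
rewrite [leRHS](_ : _ = 16 * k%:R * (4 / eps + 1)); last first.
  by field; rewrite !lt0r_neq0// (lt_le_trans _ k1).
by nra.
Qed.

(* Bundle [l] carries the extra good [None]; without it all bundles are
   exchangeable, and it decides the comparison whenever [s] is on top by less
   than [eps]. *)
Lemma pr_smaller_bundle_top (D : set R -> \bar R) (k t : nat)
    (X : option ('I_k * 'I_t) -> T -> R) (s l : 'I_k) (eps : R) :
  iid_law D P X -> (forall y, D [set y] = 0%E) ->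
  (forall i w, 0 <= X i w <= 1) -> (0 < t)%N -> s != l ->
  0 < eps -> 2^-1 <= fine (D `[eps, +oo[%classic) ->
  pr P [set w |
    (forall j, \sum_h X (Some (j, h)) w <= \sum_h X (Some (s, h)) w) /\
    \sum_h X (Some (l, h)) w + X None w <= \sum_h X (Some (s, h)) w] <=
  k%:R^-1 - margin k eps / Num.sqrt t%:R.
Proof.
move=> iidX D0 X01 t0 sl eps0 Deps.
pose Y := block_sum (fun p => X (Some p)).
rewrite -[mkset _]/[set w |
  (forall j, Y j w <= Y s w) /\ Y l w + X None w <= Y s w].
have k0 : (0 < k)%N by exact: leq_ltn_trans (leq0n s) (ltn_ord s).
have iidX' : iid_law D P (fun p => X (Some p)).
  exact: iid_law_reindex (@Some_inj _) iidX.
have iidY : iid_law (fun B => P (Y s @^-1` B)) P Y := block_sum_iid iidX' s.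
have mY i : measurable_fun setT (Y i) by case: iidY.
have mX i : measurable_fun setT (X i) by case: iidX.
have mtop := measurable_top iidY s.
have mnear := measurable_near_top iidY eps s l.
pose big := [set w | eps <= X None w].
have mbig : measurable big by exact: measurable_set_le.
have top_le : pr P (top Y s) <= k%:R^-1.
  apply: (pr_top_le iidY) => x.
  by apply: (block_sum_atomless iidX') => //; rewrite card_ord.
(* Enough bins of width [eps] to cover a window of length [4 * sqrt t]; rounding up adds at most 1,
   which is at most [sqrt t]. *)
pose N := (Num.trunc (4 * Num.sqrt t%:R / eps)).+1.
have sqt : 1 <= Num.sqrt t%:R :> R by rewrite -[leLHS]sqrtr1 ler_sqrt// ler1n.
have u0 : 0 <= 4 * Num.sqrt t%:R / eps.
  by rewrite divr_ge0 ?mulr_ge0 ?sqrtr_ge0// ltW.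
have /andP[Nl Nu] := Num.Theory.truncn_itv u0.
have Nge : 4 * Num.sqrt t%:R <= N%:R * eps by rewrite -ler_pdivrMr// ltW.
have Nle : N%:R <= (4 / eps + 1) * Num.sqrt t%:R.
  rewrite /N -[leLHS]natr1 [leRHS]mulrDl mul1r. apply: lerD => //.
  by apply: le_trans Nl _; rewrite mulrAC.
have near_ge : 2^-1 ^+ k / (16 * N%:R * k%:R ^+ 2) <= pr P (near_top Y eps s l).
  pose r := [seq Some (s, h) | h <- enum 'I_t].
  have ur : uniq r by rewrite map_inj_uniq ?enum_uniq// => h h' [].
  have szr : size r = t by rewrite size_map size_enum_ord.
  have [|lo hlo] := sum_window iidX X01 ur; first by rewrite szr.
  apply: (pr_near_top_ge iidY sl eps0 (ltn0Sn _) (lo := lo)).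
  have := hlo (N%:R * eps); rewrite szr => /(_ Nge).
  rewrite (_ : mkset _ = [set w | lo <= Y s w < lo + N%:R * eps])//.
  by apply/funext => w; rewrite /mkset /r big_map big_enum.
(* The near-top event reads only the [Some] coordinates, [big] only the coordinate [None]. *)
have indep : pr P (near_top Y eps s l `&` big) =
    pr P (near_top Y eps s l) * pr P big.
  pose bs j (v : @vecs R (option ('I_k * 'I_t))) : R := \sum_h v (Some (j, h)).
  have mbs j : measurable_fun setT (bs j).
    by apply: measurable_sum => h; exact: measurable_coord.
  pose S1 : set (@vecs R (option ('I_k * 'I_t))) :=
    [set v | forall j, bs j v <= bs s v] `&` [set v | bs s v < bs l v + eps].
  pose S2 : set (@vecs R (option ('I_k * 'I_t))) := [set v | eps <= v None].
  have mS1 : measurable S1.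
    apply: measurableI.
      by apply: measurable_forall => j; exact: measurable_set_le.
    by apply: measurable_set_lt => //; exact: measurable_funD.
  have mS2 : measurable S2.
    by apply: measurable_set_le => //; exact: measurable_coord.
  apply: EFin_inj; rewrite EFinM -!prE//; last exact: measurableI.
  apply: (iid_law_indep (J := predC1 None) iidX mS1 mS2).
  - have sub u u' : (forall j, bs j u = bs j u') -> S1 u -> S1 u'.
      by move=> e [h1 h2]; split=> [j|]; rewrite /= -!e; [exact: h1|exact: h2].
    move=> v v' vv'; apply/propext; split; apply: sub => j;
      by apply: eq_bigr => h _; rewrite vv'.
  - by move=> v v' vv'; rewrite /S2/= vv'//= eqxx.
have prbig : 2^-1 <= pr P big.
  rewrite (_ : pr P big = fine (D `[eps, +oo[%classic))//.
  rewrite -(iid_law_marginal None iidX)//; congr (fine (P _)).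
  by apply/seteqP; split=> w /=; rewrite in_itv/= andbT.
(* When [s] is near the top and the extra good is worth at least [eps], bundle [l] with that good
   beats bundle [s]; this part of the top event is lost. *)
apply: (@le_trans _ _ (pr P (top Y s `\` (near_top Y eps s l `&` big)))).
  apply: le_pr.
  - apply: measurableI => //.
    by apply: measurable_set_le => //; exact: measurable_funD.
  - by apply: measurableD => //; exact: measurableI.
  - move=> w [h1 h2]; split=> // -[[_ /=]]; rewrite /big/= => h3 h4.
    by have := lt_le_trans h3 (lerD (lexx (Y l w)) h4); rewrite ltNge h2.
rewrite pr_setD//; [|exact: measurableI|by move=> w [[]]].
rewrite lerB// indep.
have Npos : 0 < 16 * N%:R * k%:R ^+ 2 :> R.
  by rewrite mulr_gt0 ?mulr_gt0 ?exprn_gt0 ?ltr0n.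
apply: (@le_trans _ _ (2^-1 ^+ k / (16 * N%:R * k%:R ^+ 2) * 2^-1)); last first.
  by apply: ler_pM => //; rewrite divr_ge0 ?exprn_ge0 ?invr_ge0// ltW.
have e0 : 0 < 4 / eps + 1 by rewrite ltr_wpDl// divr_ge0// ltW.
have r0 : 0 < Num.sqrt t%:R :> R := lt_le_trans ltr01 sqt.
have N1 : 0 < N%:R :> R by rewrite ltr0n.
have k1 : 0 < k%:R :> R by rewrite ltr0n.
rewrite /margin exprSr.
have a0 : 0 <= 2^-1 ^+ k :> R by rewrite exprn_ge0 ?invr_ge0.
move: (2^-1 ^+ k) (4 / eps + 1) (Num.sqrt t%:R) N%:R k%:R a0 e0 r0 N1 k1 Nle.
move=> a e r n q a0 e0 r0 n0 q0 ner.
have -> : a * 2^-1 / (16 * q ^+ 2 * e) / r =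
    a * 2^-1 / (16 * q ^+ 2) * (e * r)^-1.
  by field; rewrite !lt0r_neq0.
have -> : a / (16 * n * q ^+ 2) * 2^-1 = a * 2^-1 / (16 * q ^+ 2) * n^-1.
  by field; rewrite !lt0r_neq0.
rewrite ler_wpM2l ?lef_pV2 ?posrE ?mulr_gt0//.
by rewrite divr_ge0 ?mulr_ge0 ?exprn_ge0 ?invr_ge0 ?(ltW q0).
Qed.

End EqualBundlesPlusOne.

(** * The probability that one agent favours a smallest bundle *)

Section Agent.
Set Implicit Arguments.
Unset Strict Implicit.
Context {R : realType}.

(** Every point outside [A] has a null open neighbourhood, hence lies in a null interval with
    rational ends, and there are countably many of these. *)
Lemma support_complement_null (D : probability (measurableTypeR R) R)
    (A : set R) : closed A -> support_of D `<=` A -> D (~` A) = 0%E.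
Proof.
move=> cA DA.
pose F (p : rat * rat) : set R := `]ratr p.1, ratr p.2[%classic.
pose Q := [set p | D (F p) = 0%E].
have mF p : measurable (F p) by exact: measurable_itv.
have mC : measurable (~` A).
  by apply: measurableC; exact: closed_measurable.
pose G n := if unpickle n is Some p then
  (if `[< D (F p) = 0%E >] then F p else set0) else set0.
have G0 n : D.-negligible (G n).
  rewrite /G; case: unpickle => [p|]; last exact: negligible_set0.
  case: asboolP => [Fp0|_]; last exact: negligible_set0.
  by apply/negligibleP; [exact: mF|exact: Fp0].
apply: (@measure_negligible _ (measurableTypeR R) R D _ mC).
apply: negligibleS (negligible_bigcup G0).
move=> x Ax.
have [U [oU Ux DU]] : exists U, [/\ open U, U x & D U = 0%E].
  apply: contrapT => h; apply: Ax; apply: DA => U oU Ux.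
  rewrite lt0e measure_ge0 andbT; apply/eqP => DU; apply: h.
  by exists U; split.
have /nbhs_ballP[e /= e0 xU] := open_nbhs_nbhs (conj oU Ux).
have xe : x - e < x by rewrite ltrBlDr ltrDl.
have ex : x < x + e by rewrite ltrDl.
have [p] := rat_in_itvoo xe; rewrite in_itv/= => /andP[p1 p2].
have [q] := rat_in_itvoo ex; rewrite in_itv/= => /andP[q1 q2].
exists (pickle (p, q)); first exact: Logic.I.
rewrite /G pickleK asboolT.
  by rewrite /F/= in_itv/= p2 q1.
apply/eqP; rewrite eq_le measure_ge0 andbT -DU.
apply: le_measure; [exact: mem_set (mF _)|exact: mem_set (open_measurable oU)|].
move=> y; rewrite /F/= in_itv/= => /andP[py yq]; apply: xU.
by rewrite /ball/= ltr_norml; apply/andP; split; lra.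
Qed.

(** The half-lines from [1 / (n + 1)] increase to the positive one, of full mass because 0 is not an
    atom; continuity from below gives one with more than half of it. *)
Lemma half_mass_away_from_0 (D : probability (measurableTypeR R) R) :
  non_atomic D -> D (~` `[0, 1]%classic) = 0%E ->
  exists2 eps : R, 0 < eps & 2^-1 <= fine (D `[eps, +oo[%classic).
Proof.
move=> D0 D01.
pose F n : set R := `[n.+1%:R^-1, +oo[%classic.
have mF n : measurable (F n) by exact: measurable_itv.
have UF : \bigcup_n F n = `]0, +oo[%classic.
  apply/seteqP; split=> x /=.
    move=> [n _]; rewrite /F/= !in_itv/= !andbT; apply: lt_le_trans.
    by rewrite invr_gt0.
  rewrite in_itv/= andbT => x0; exists (Num.trunc x^-1) => //.
  rewrite /F/= in_itv/= andbT invf_ple ?posrE//; apply: ltW.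
  have x1 : 0 <= x^-1 by rewrite invr_ge0 ltW.
  by have /andP[] := Num.Theory.truncn_itv x1.
have D1 : D `]0, +oo[%classic = 1%E.
  have m0 : measurable (`]0, +oo[%classic : set R) by exact: measurable_itv.
  have mC : measurable (~` `[0, 1]%classic : set R).
    by apply: measurableC; exact: measurable_itv.
  have m1 : measurable ([set 0] : set R) by exact: measurable_set1.
  have sub : [set: R] `<=` `]0, +oo[%classic `|` [set 0%R] `|` ~` `[0, 1]%classic.
    move=> x _; rewrite /= !in_itv/= andbT.
    have [x0|x0|->] := ltgtP x 0; [|by left; left|by left; right].
    by right.
  have := @le_measure _ _ _ D _ _ (mem_set measurableT)
    (mem_set (measurableU _ _ (measurableU _ _ m0 m1) mC)) sub.
  rewrite [X in (X <= _)%E](probability_setT D) => h.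
  apply/eqP; rewrite eq_le probability_le1//=.
  apply: (le_trans h); apply: le_trans
    (@measureU2 _ _ _ D _ _ (measurableU _ _ m0 m1) mC) _.
  rewrite [X in (_ + X)%E]D01 adde0; apply: le_trans (@measureU2 _ _ _ D _ _ m0 m1) _.
  by rewrite [X in (_ + X)%E]D0 adde0.
have : D \o F @ \oo --> D (\bigcup_n F n).
  apply: nondecreasing_cvg_mu => //; first by rewrite UF.
  move=> m n mn; apply/subsetPset => x; rewrite /F/= !in_itv/= !andbT.
  by apply: le_trans; rewrite lef_pV2 ?posrE// ler_nat.
rewrite UF D1 => /(_ [set x | (2^-1%:E < x)%E]) [].
  apply: open_nbhs_nbhs; split; first exact: open_ereal_gt_ereal.
  by rewrite /= lte_fin invf_lt1 ?ltr1n.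
move=> n _ /(_ n (leqnn n)) /= h; exists n.+1%:R^-1; first by rewrite invr_gt0.
by rewrite -lee_fin fineK ?fin_num_measure//; exact: ltW.
Qed.

Lemma ler_sum_reindex (I H : finType) (v : I -> R) (A : {set I}) (f : H -> I) :
  (forall i, 0 <= v i) -> injective f -> (forall h, f h \in A) ->
  \sum_h v (f h) <= \sum_(i in A) v i.
Proof.
move=> v0 finj fA.
have -> : \sum_h v (f h) = \sum_(i in [set f h | h : H]%SET) v i.
  by rewrite big_imset//= => h h' _ _ /finj.
rewrite [leRHS](bigID [in [set f h | h : H]%SET])/= -[leLHS]addr0 lerD//.
  rewrite le_eqVlt (eq_bigl (fun i => (i \in A) && (i \in [set f h | h : H]%SET)))
    ?eqxx// => i.
  by apply/idP/andP => [fi|[]//]; split=> //; case/imsetP: fi => h _ ->.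
by apply: sumr_ge0.
Qed.

Lemma eq_sum_reindex (I H : finType) (v : I -> R) (A : {set I}) (f : H -> I) :
  injective f -> (forall h, f h \in A) -> #|A| = #|H| ->
  \sum_h v (f h) = \sum_(i in A) v i.
Proof.
move=> finj fA AH.
have <- : [set f h | h : H]%SET = A.
  apply/eqP; rewrite eqEcard; apply/andP; split.
    by apply/fintype.subsetP => i /imsetP[h _ ->].
  by rewrite AH card_imset.
by rewrite big_imset//= => h h' _ _ /finj.
Qed.

Lemma measurable_bundle_utility d' (T' : measurableType d') (m : nat)
    (x : 'I_m -> T' -> R) (B : {set 'I_m}) :
  (forall g, measurable_fun setT (x g)) ->
  measurable_fun setT (fun w => bundle_utility (x ^~ w) B).
Proof.
move=> mx; rewrite (_ : (fun w => _) = fun w => \sum_(g <- enum B) x g w).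
  exact: measurable_sum.
by apply/funext => w; rewrite big_enum.
Qed.

Lemma measurable_favourite (m k : nat) (A : {ffun 'I_k -> {set 'I_m}})
    (s : 'I_k) :
  measurable [set v : @vecs R 'I_m |
    forall j, bundle_utility v (A j) <= bundle_utility v (A s)].
Proof.
apply: measurable_forall => j.
by apply: measurable_set_le;
  apply: (@measurable_bundle_utility _ (@vecs R 'I_m) m (fun g v => v g)) => g;
  exact: measurable_coord.
Qed.

Context {d} {T : measurableType d} (P : probability T R).

(** Truncating the rivals of [A s] only drops nonnegative terms and leaves [A s] intact, so the
    event grows into the one for equal bundles with one extra good. *)
Lemma pr_favourite_smallest (D : probability (measurableTypeR R) R)
    (m k : nat) (X : 'I_m -> T -> R) (A : {ffun 'I_k -> {set 'I_m}})
    (s l : 'I_k) (eps : R) :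
  iid_law D P X -> non_atomic D -> D (~` `[0, 1]%classic) = 0%E ->
  0 < eps -> 2^-1 <= fine (D `[eps, +oo[%classic) ->
  (forall i j, i != j -> (A i :&: A j)%SET = finset.set0) ->
  (forall j, (#|A s| <= #|A j|)%N) -> (#|A s| < #|A l|)%N ->
  pr P [set w | forall j, bundle_utility (X ^~ w) (A j) <=
                          bundle_utility (X ^~ w) (A s)] <=
  k%:R^-1 - margin k eps / Num.sqrt m%:R.
Proof.
move=> iidX0 D0 D01 eps0 Deps disA smin sl.
have k0 : (0 < k)%N by exact: leq_ltn_trans (leq0n s) (ltn_ord s).
have mar0 := margin_gt0 k0 eps0.
(* Clipping puts the values in the unit interval everywhere, not just almost surely, and keeps the
   joint law. *)
pose clip (x : R) : R := Num.max 0 (Num.min 1 x).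
pose X' i w := clip (X i w).
have iidX : iid_law D P X'.
  apply: (@iid_law_comp _ D _ _ _ _ _ clip `[0, 1]%classic) => //.
  - by apply: measurable_maxr => //; exact: measurable_minr.
  - move=> x /=; rewrite in_itv/= => /andP[x0 x1].
    by rewrite /clip min_r// max_r.
have X01 i w : 0 <= X' i w <= 1.
  by rewrite /X' /clip le_max lexx/= ge_max ler01 ge_min lexx.
have -> : pr P [set w | forall j, bundle_utility (X ^~ w) (A j) <=
                          bundle_utility (X ^~ w) (A s)] =
    pr P [set w | forall j, bundle_utility (X' ^~ w) (A j) <=
                          bundle_utility (X' ^~ w) (A s)].
  have h := iid_law_transfer iidX0 iidX (measurable_favourite A s).
  by congr fine; exact: h.
move: (X') iidX X01 => {iidX0}{}X' iidX X01.
pose t := #|A s|.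
have [g0 g0l] : exists g0, g0 \in A l.
  by apply/card_gt0P; exact: leq_ltn_trans (leq0n _) sl.
have mm : (t <= m)%N by rewrite -[leqRHS]card_ord max_card.
have m0 : (0 < m)%N by exact: leq_ltn_trans (leq0n g0) (ltn_ord g0).
have mE : measurable [set w | forall j, bundle_utility (X' ^~ w) (A j) <=
                          bundle_utility (X' ^~ w) (A s)].
  exact: measurable_vector_event iidX (measurable_favourite A s).
have [t0|t0] := posnP t.
  (* An empty [A s] is a favourite only if the good [g0] of [A l] is worth at most 0, a null
     event. *)
  apply: (@le_trans _ _ 0).
    have <- : pr P [set w | X' g0 w <= 0] = 0.
      have -> : [set w | X' g0 w <= 0] = X' g0 @^-1` `]-oo, 0]%classic.
        by apply/seteqP; split=> w /=; rewrite in_itv.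
      rewrite /pr (iid_law_marginal _ iidX)//.
      have mC : measurable (~` `[0, 1]%classic : set R).
        by apply: measurableC; exact: measurable_itv.
      have m1 : measurable ([set 0] : set R) by exact: measurable_set1.
      have mN : measurable (`]-oo, 0]%classic : set R) by exact: measurable_itv.
      have sub : (`]-oo, 0]%classic : set R) `<=`
          ~` `[0, 1]%classic `|` [set 0%R].
        move=> x; rewrite /= !in_itv/= le_eqVlt => /predU1P[->|x0]; first by right.
        by left; rewrite leNgt x0.
      have := @le_measure _ _ _ D _ _ (mem_set mN)
        (mem_set (measurableU _ _ mC m1)) sub.
      move=> /le_trans /(_ (@measureU2 _ _ _ D _ _ mC m1)).
      rewrite [X in (_ <= X + _)%E]D01 [X in (_ <= _ + X)%E]D0 adde0 measure_le0.
      by move=> /eqP ->.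
    apply: le_pr => //.
      by case: iidX => _ mX _; exact: measurable_set_le.
    move=> w /(_ l); have /eqP := t0; rewrite cards_eq0 => /eqP As0.
    rewrite /bundle_utility As0 big_set0 (bigD1 g0)//=.
    apply: le_trans; rewrite lerDl; apply: sumr_ge0 => i _.
    by case/andP: (X01 i w).
  have sqm : 1 <= Num.sqrt m%:R :> R by rewrite -[leLHS]sqrtr1 ler_sqrt// ler1n.
  rewrite subr_ge0 ler_pdivrMr ?(lt_le_trans _ sqm)//.
  apply: (@le_trans _ _ k%:R^-1); last by rewrite ler_peMr ?invr_ge0.
  exact: margin_le.
(* Weakening from [t] to [m] makes the bound uniform over allocations. *)
apply: (@le_trans _ _ (k%:R^-1 - margin k eps / Num.sqrt t%:R)); last first.
  rewrite lerB// ler_wpM2l ?(ltW mar0)// lef_pV2 ?posrE ?sqrtr_gt0 ?ltr0n//.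
  by rewrite ler_sqrt ?ltr0n// ler_nat.
(* [Some (j, h)] picks the good of index [h < t] in [A j]; [None] picks index [t] in [A l], the
   first one past the truncation, which exists as [t < #|A l|]. *)
pose f (o : option ('I_k * 'I_t)) : 'I_m :=
  if o is Some (j, h) then nth g0 (enum (A j)) h else nth g0 (enum (A l)) t.
have fA j (h : 'I_t) : f (Some (j, h)) \in A j.
  by rewrite -mem_enum mem_nth// -cardE (leq_trans (ltn_ord h))//; exact: smin.
have fl : f None \in A l by rewrite -mem_enum mem_nth// -cardE.
have inA i j g : g \in A i -> g \in A j -> i = j.
  move=> gi gj; apply/eqP/negPn/negP => /disA/setP/(_ g).
  by rewrite !inE gi gj.
have fjinj j : injective (fun h => f (Some (j, h))).
  move=> h h' /eqP.
  rewrite nth_uniq ?enum_uniq -?cardE ?(leq_trans _ (smin j))//.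
  by move=> /eqP/val_inj.
have fN (i : 'I_t) : f (Some (l, i)) <> f None.
  move=> /eqP.
  rewrite nth_uniq ?enum_uniq -?cardE ?(ltn_trans (ltn_ord i) sl)//.
  by rewrite ltn_eqF.
have finj : injective f.
  move=> [[j h]|] [[j' h']|] e; last by [].
  - have jj' : j = j' by apply: (inA _ _ _ (fA j h)); rewrite e; exact: fA.
    by move: e; rewrite jj' => /fjinj ->.
  - have jl : j = l by apply: (inA _ _ _ (fA j h)); rewrite e.
    by exfalso; apply: (fN h); rewrite -jl.
  - have jl : j' = l by apply: (inA _ _ _ (fA j' h')); rewrite -e.
    by exfalso; apply: (fN h'); rewrite -jl.
have iidf := iid_law_reindex finj iidX.
have sl' : s != l by apply: contraTneq sl => ->; rewrite ltnn.
have := pr_smaller_bundle_top iidf D0 (fun o => X01 (f o)) t0 sl' eps0 Deps.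
apply: le_trans; apply: le_pr => //.
  have mX o : measurable_fun setT (X' (f o)) by case: iidf.
  have mS j : measurable_fun setT (fun w => \sum_h X' (f (Some (j, h))) w).
    exact: measurable_sum.
  apply: measurableI.
    by apply: measurable_forall => j; exact: measurable_set_le.
  by apply: measurable_set_le => //; exact: measurable_funD.
move=> w top_s.
have Xs : \sum_h0 X' (f (Some (s, h0))) w = bundle_utility (X' ^~ w) (A s).
  by apply: (eq_sum_reindex (X' ^~ w) (@fjinj s)) => //; rewrite card_ord.
split=> [j|]; rewrite Xs; apply: le_trans (top_s _).
- apply: (ler_sum_reindex _ (@fjinj j)) => // i; by case/andP: (X01 i w).
- pose fo (o : option 'I_t) := f (omap (pair l) o).
  have pinj : injective (omap (pair l) : option 'I_t -> _).
    by move=> [h1|] [h2|] //= [->].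
  have foinj : injective fo := inj_comp finj pinj.
  have := ler_sum_reindex (v := X' ^~ w) (A := A l) _ foinj.
  rewrite (bigD1 None)//= (reindex_omap Some id)/=; last by case.
  under eq_bigl do rewrite eqxx.
  rewrite addrC; apply; first by move=> i; case/andP: (X01 i w).
  by move=> [h1|]; [exact: fA|exact: fl].
Qed.

End Agent.

(** * Chernoff bound for independent events *)

Section Chernoff.
Set Implicit Arguments.
Unset Strict Implicit.
Context {R : realType} {d} {T : measurableType d} (P : probability T R).

Lemma prod_1D (I : finType) (x : I -> R) :
  \prod_i (1 + x i) = \sum_(J : {set I}) \prod_(i in J) x i.
Proof.
under eq_bigr do rewrite addrC.
by rewrite bigA_distr; apply: eq_bigr => J _; rewrite -big_mkcond.
Qed.

(* Exponential Markov inequality: if [N] events occur, then [(1 + la) ^ N]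
   expands over the sets of occurring events. *)
Lemma independent_events_tail (I : finType) (E : I -> set T) (q la : R)
    (r : nat) :
  (forall i, measurable (E i)) ->
  (forall J : {set I}, P [set w | forall i, i \in J -> E i w] =
    (\prod_(i in J) P (E i))%E) ->
  (forall i, pr P (E i) <= q) -> 0 <= la ->
  pr P [set w | exists2 C : {set I}, (r <= #|C|)%N &
                 forall i, i \in C -> E i w] * (1 + la) ^+ r <=
  (1 + la * q) ^+ #|I|.
Proof.
move=> mE indE Eq la0.
set B := mkset _.
pose EJ (J : {set I}) := [set w | forall i, i \in J -> E i w].
have mEJ J : measurable (EJ J).
  rewrite (_ : EJ J = [set w | forall i, (if i \in J then E i else setT) w]).
    by apply: measurable_forall => i; case: ifP.
  by apply/seteqP; split=> w /= h i; have := h i; case: ifP => //= _; exact.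
have mB : measurable B.
  rewrite (_ : B = [set w | exists C : {set I},
      (if (r <= #|C|)%N then EJ C else set0) w]).
    rewrite (_ : mkset _ = \bigcup_(C in [set: {set I}])
        (if (r <= #|C|)%N then EJ C else set0)).
      apply: fin_bigcup_measurable; first exact: finite_finset.
      by move=> C _; case: ifP.
    by apply/seteqP; split=> w /= [C]; [exists C|move=> ?; exists C].
  by apply/seteqP; split=> w /= [C]; [move=> rC h; exists C; rewrite rC|
    case: ifP => // rC h; exists C].
(* The terms in the expansion of the product of the [1 + la * \1_(E i)]; by independence their
   integrals recombine into a product. *)
pose g (J : {set I}) w : R := la ^+ #|J| * \1_(EJ J) w.
have g0 J w : 0 <= g J w by rewrite /g mulr_ge0 ?exprn_ge0.
have mg J : measurable_fun setT (g J).
  by apply: measurable_funM => //; exact: measurable_indic.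
have gE w : \sum_J g J w = \prod_i (1 + la * \1_(E i) w).
  rewrite prod_1D; apply: eq_bigr => J _; rewrite /g big_split/= prodr_const.
  congr (_ * _); rewrite indicE; case: (boolP (w \in EJ J)).
    move=> /set_mem wJ; rewrite big1// => i iJ; rewrite indicE mem_set//.
    exact: wJ.
  move=> wJ; have [i iJ wi] : exists2 i, i \in J & ~ E i w.
    apply: contrapT => h; move/negP: wJ; apply; apply: mem_set => i iJ.
    by apply: contrapT => wi; apply: h; exists i.
  by rewrite (bigD1 i)//= indicE memNset// mul0r.
have gB w : (1 + la) ^+ r * \1_B w <= \sum_J g J w.
  rewrite indicE; case: (boolP (w \in B)) => wB; last first.
    by rewrite mulr0; apply: sumr_ge0 => J _; exact: g0.
  move/set_mem: wB => -[C rC wC]; rewrite mulr1 gE.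
  apply: (@le_trans _ _ (\prod_(i in C) (1 + la))).
    by rewrite prodr_const ler_weXn2l// lerDl.
  rewrite big_mkcond/=; apply: ler_prod => i _; case: ifPn => iC.
    by rewrite indicE mem_set ?mulr1 ?lexx ?addr_ge0//; exact: wC.
  by rewrite ler01/= lerDl mulr_ge0.
have : (\int[P]_w ((1 + la) ^+ r * \1_B w)%:E <=
    \int[P]_w (\sum_J (g J w)%:E)%E)%E.
  apply: ge0_le_integral => //.
  - by move=> w _; rewrite lee_fin mulr_ge0 ?exprn_ge0 ?addr_ge0.
  - apply/measurable_EFinP; apply: measurable_funM => //.
  - by apply: emeasurable_sum => J; exact/measurable_EFinP.
  - by move=> w _; rewrite sumEFin lee_fin.
rewrite ge0_integral_sum//; last 2 first.
- by move=> J; exact/measurable_EFinP.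
- by move=> J w _; rewrite lee_fin.
have intE (c : R) (A : set T) : 0 <= c -> measurable A ->
    (\int[P]_w (c * \1_A w)%:E = (c * pr P A)%:E)%E.
  move=> c0 mA; under eq_integral do rewrite EFinM.
  rewrite ge0_integralZl//; last exact/measurable_EFinP/measurable_indic.
  by rewrite integral_indic// setIT EFinM -prE.
rewrite intE ?exprn_ge0 ?addr_ge0//.
under eq_bigr do rewrite intE ?exprn_ge0//.
rewrite sumEFin lee_fin mulrC => /le_trans; apply.
have -> : \sum_(J : {set I}) la ^+ #|J| * pr P (EJ J) =
    \prod_i (1 + la * pr P (E i)).
  rewrite prod_1D; apply: eq_bigr => J _.
  rewrite big_split/= prodr_const; congr (_ * _).
  apply: EFin_inj; rewrite -prE// indE -prodEFin.
  by apply: eq_bigr => i _; rewrite prE.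
apply: (@le_trans _ _ (\prod_(i : I) (1 + la * q))); last first.
  by rewrite prodr_const.
apply: ler_prod => i _; rewrite addr_ge0 ?mulr_ge0 ?pr_ge0//=.
by rewrite lerD2l ler_wpM2l.
Qed.

(** The bound [1 - y <= exp (- y)] at [y = x / (1 + x)] gives [exp y <= 1 + x], and
    [x - x ^+ 2 <= y]. *)
Lemma expR_lower_1D (x : R) : 0 <= x -> expR (x - x ^+ 2) <= 1 + x.
Proof.
move=> x0.
have y0 : 0 < 1 + x by rewrite ltr_pwDl.
have : 1 - x / (1 + x) <= expR (- (x / (1 + x))) by exact: expR_ge1Dx.
rewrite expRN => h.
have e1 : expR (x / (1 + x)) <= 1 + x.
  rewrite -[leRHS]invrK -[leLHS]invrK lef_pV2 ?posrE ?invr_gt0 ?expR_gt0//.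
  by apply: le_trans h; rewrite le_eqVlt; apply/orP; left; apply/eqP; field;
    rewrite lt0r_neq0.
apply: le_trans e1; rewrite ler_expR ler_pdivlMr//.
by have := exprn_ge0 3 x0; rewrite !exprS expr0; lra.
Qed.

Lemma chernoff (I : finType) (E : I -> set T) (q del : R) (k r : nat) :
  (forall i, measurable (E i)) ->
  (forall J : {set I}, P [set w | forall i, i \in J -> E i w] =
    (\prod_(i in J) P (E i))%E) ->
  (0 < k)%N -> #|I| = (k * r)%N -> 0 <= del ->
  (forall i, pr P (E i) <= k%:R^-1 - del) ->
  pr P [set w | exists2 C : {set I}, (r <= #|C|)%N &
                 forall i, i \in C -> E i w] <=
  expR (- (#|I|%:R * k%:R * del ^+ 2 / 4)).
Proof.
move=> mE indE k0 Ikr del0 Edel.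
have k1 : 0 < k%:R :> R by rewrite ltr0n.
(* With [n = #|I|] the final exponent is [n * (la ^+ 2 / k - la * del)], least at this [la]. *)
pose la : R := k%:R * del / 2.
have la0 : 0 <= la by rewrite divr_ge0 ?mulr_ge0// ltW.
have := independent_events_tail r mE indE Edel la0.
set p := pr P _ => h.
have p0 : 0 <= p by exact: pr_ge0.
have n0 : 0 <= #|I|%:R :> R by [].
have h1 : p * expR (r%:R * (la - la ^+ 2)) <=
    expR (#|I|%:R * (la * (k%:R^-1 - del))).
  rewrite !expRM_natl; apply: le_trans (le_trans h _).
    rewrite ler_wpM2l// lerXn2r ?nnegrE ?expR_ge0 ?addr_ge0//.
    exact: expR_lower_1D.
  (* An index shows [k^-1 - del] to be nonnegative, as it bounds a probability; if there is none,
     both powers are 1. *)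
  case: (pickP (mem I)) => [i _|I0]; last first.
    by rewrite (eq_card0 (A := I))// !expr0.
  rewrite lerXn2r ?nnegrE ?expR_ge0 ?expR_ge1Dx// addr_ge0// mulr_ge0//.
  exact: le_trans (pr_ge0 _ _) (Edel i).
rewrite -ler_pdivlMr ?expR_gt0// in h1.
apply: (le_trans h1); rewrite -expRN -expRD ler_expR.
have -> : r%:R = #|I|%:R / k%:R :> R.
  by rewrite Ikr natrM mulrAC divff ?mul1r// lt0r_neq0.
rewrite le_eqVlt; apply/orP; left; apply/eqP.
by rewrite /la; field; rewrite lt0r_neq0.
Qed.

End Chernoff.

(** * Union bound over allocations *)

Section UnionBound.
Set Implicit Arguments.
Unset Strict Implicit.
Context {R : realType} {d} {T : measurableType d} (P : probability T R).

Lemma iid_utilities_law (D : probability (measurableTypeR R) R) (n m : nat)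
    (u : 'I_n -> 'I_m -> {RV P >-> R}) :
  iid_utilities D u ->
  iid_law D P (fun (ag : 'I_n * 'I_m) w => u ag.1 ag.2 w).
Proof.
move=> [indep law]; split; first exact: probability_setT.
  by move=> ag; exact: measurable_funPT.
move=> B mB; have := indep [set: 'I_n * 'I_m]%SET B mB.
rewrite (_ : \bigcap_(i in _) _ =
    [set w | forall ag : 'I_n * 'I_m, B ag (u ag.1 ag.2 w)]); last first.
  apply/seteqP; split=> w /= h ag; first by apply: h; rewrite /= inE.
  by move=> _; exact: h.
move=> ->; apply: eq_big => [ag|ag _]; first by rewrite inE.
exact: law.
Qed.

Lemma sum_card_indexed_partition (I : finType) (k : nat)
    (S : {ffun 'I_k -> {set I}}) :
  Defs.indexed_partition S -> (\sum_j #|S j|)%N = #|I|.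
Proof.
move=> [disj cover].
under eq_bigr do rewrite -sum1_card big_mkcond/=.
rewrite exchange_big/= -sum1_card; apply: eq_bigr => i _.
have : i \in (\bigcup_(j < k) S j)%SET by rewrite cover inE.
move=> /bigcupP[j _ ij]; rewrite (bigD1 j)//= ij big1 ?addn0// => j' jj'.
case: ifPn => // ij'; have /setP/(_ i) := disj _ _ jj'.
by rewrite !inE ij ij'.
Qed.

(** If all sizes were equal, [k] would divide [m]. *)
Lemma unequal_bundles (m k : nat) (A : {ffun 'I_k -> {set 'I_m}}) (s : 'I_k) :
  Defs.indexed_partition A -> ~~ (k %| m)%N ->
  (forall j, (#|A s| <= #|A j|)%N) ->
  exists l, (#|A s| < #|A l|)%N.
Proof.
move=> pA km smin; apply: contrapT => h.
have e j : #|A j| = #|A s|.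
  apply/eqP; rewrite eqn_leq smin andbT leqNgt; apply/negP => sj.
  by apply: h; exists j.
move/negP: km; apply.
rewrite -[m]card_ord -(sum_card_indexed_partition pA).
by under eq_bigr do rewrite e; rewrite sum_nat_const card_ord dvdn_mulr.
Qed.

Definition favourite (n m k : nat) (v : 'I_n -> 'I_m -> R)
    (A : {ffun 'I_k -> {set 'I_m}}) (s : 'I_k) (a : 'I_n) : Prop :=
  forall j, bundle_utility (v a) (A j) <= bundle_utility (v a) (A s).

Variables (D : probability (measurableTypeR R) R) (n m k : nat).
Variables (u : 'I_n -> 'I_m -> {RV P >-> R}).
Hypothesis iidu : iid_utilities D u.

Let v w := fun a g => u a g w.

Lemma measurable_favourite_agent (A : {ffun 'I_k -> {set 'I_m}}) s a :
  measurable [set w | favourite (v w) A s a].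
Proof.
have iida : iid_law D P (fun g w => u a g w).
  apply: (iid_law_reindex (f := pair a) _ (iid_utilities_law iidu)).
  by move=> g g' [].
exact: measurable_vector_event iida (measurable_favourite A s).
Qed.

Lemma measurable_envy_free_outcome_exists :
  measurable [set w | envy_free_outcome_exists k (v w)].
Proof.
pose E (p : {ffun 'I_k -> {set 'I_n}} * {ffun 'I_k -> {set 'I_m}}) : set T :=
  if `[< is_outcome p.1 p.2 >] then
    [set w | forall (ia : 'I_k * 'I_n),
      (if ia.2 \in p.1 ia.1 then [set w | favourite (v w) p.2 ia.1 ia.2]
       else setT) w]
  else set0.
rewrite (_ : mkset _ = \bigcup_(p in setT) E p).
  apply: fin_bigcup_measurable; first exact: finite_finset.
  move=> p _; rewrite /E; case: ifP => // _; apply: measurable_forall => ia.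
  by case: ifP => // _; exact: measurable_favourite_agent.
apply/seteqP; split=> w /=.
  move=> [C [A [oCA ef]]]; exists (C, A) => //; rewrite /E asboolT//= => -[i a]/=.
  by case: ifP => // aC j; exact: ef.
move=> [[C A] _]; rewrite /E; case: asboolP => // oCA h; exists C, A; split=> //.
by move=> i j a aC; have := h (i, a); rewrite /= aC; exact.
Qed.

(** For each allocation the Chernoff bound is applied to the admirers of a smallest bundle; there
    are [2 ^ (m * k)] families of bundles, at most [exp (m * k)]. *)
Lemma pr_envy_free_le (eps : R) :
  non_atomic D -> D (~` `[0, 1]%classic) = 0%E ->
  0 < eps -> 2^-1 <= fine (D `[eps, +oo[%classic) ->
  (0 < k)%N -> (0 < m)%N -> (k %| n)%N -> ~~ (k %| m)%N ->
  pr P [set w | envy_free_outcome_exists k (v w)] <=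
  expR ((m * k)%:R - k%:R * margin k eps ^+ 2 / 4 * (n%:R / m%:R)).
Proof.
move=> D0 D01 eps0 Deps k0 m0 kn km.
set rhs := expR _.
have iidU := iid_utilities_law iidu.
pose s0 := Ordinal k0.
pose s (A : {ffun 'I_k -> {set 'I_m}}) := [arg min_(s < s0) #|A s|].
have smin (A : {ffun 'I_k -> {set 'I_m}}) j : (#|A (s A)| <= #|A j|)%N.
  by rewrite /s; case: arg_minnP => // i _; exact.
(* Only the number of agents favouring bundle [s A] is recorded, not the grouping, so the union
   ranges over allocations alone. *)
pose many (A : {ffun 'I_k -> {set 'I_m}}) : set T := [set w |
  exists2 C : {set 'I_n}, (n %/ k <= #|C|)%N &
    forall a, a \in C -> favourite (v w) A (s A) a].
pose E (A : {ffun 'I_k -> {set 'I_m}}) :=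
  if `[< Defs.indexed_partition A >] then many A else set0.
have mmany (A : {ffun 'I_k -> {set 'I_m}}) : measurable (many A).
  rewrite (_ : many A = \bigcup_(C in [set: {set 'I_n}])
      (if (n %/ k <= #|C|)%N then
        [set w | forall a, (if a \in C then
          [set w | favourite (v w) A (s A) a] else setT) w] else set0)).
    apply: fin_bigcup_measurable; first exact: finite_finset.
    move=> C _; case: ifP => // _; apply: measurable_forall => a.
    by case: ifP => // _; exact: measurable_favourite_agent.
  apply/seteqP; split=> w /=.
    move=> [C nC h]; exists C => //; rewrite nC => a /=.
    by case: ifP => // /h.
  move=> [C _]; case: ifP => // nC h; exists C => // a aC.
  by have := h a; rewrite aC.
have mE (A : {ffun 'I_k -> {set 'I_m}}) : measurable (E A).
  by rewrite /E; case: ifP.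
have prE_le (A : {ffun 'I_k -> {set 'I_m}}) :
    pr P (E A) <= expR (- (k%:R * margin k eps ^+ 2 / 4 * (n%:R / m%:R))).
  rewrite /E; case: asboolP => [pA|_]; last by rewrite /pr measure0 expR_ge0.
  have [l sl] := unequal_bundles pA km (smin A).
  have iida a : iid_law D P (fun g w => u a g w).
    apply: (iid_law_reindex (f := pair a) _ iidU).
    by move=> g g' [].
  pose S (a : 'I_n) : set (@vecs R ('I_n * 'I_m)%type) :=
    [set x | favourite (fun a g => x (a, g)) A (s A) a].
  have mS a : measurable (S a).
    apply: measurable_forall => j.
    by apply: measurable_set_le;
      apply: (@measurable_bundle_utility _ _ (@vecs R ('I_n * 'I_m)%type) m
        (fun g v => v (a, g))) => g; exact: measurable_coord.
  have dS a : depends_on (fun ag => ag.1 == a) (S a).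
    move=> x x' xx'; apply/propext; rewrite /S/= /favourite.
    have e B : bundle_utility (fun g => x (a, g)) B =
        bundle_utility (fun g => x' (a, g)) B.
      by apply: eq_bigr => g _; rewrite xx'/=.
    by split=> h j; move: (h j); rewrite !e.
  have := @chernoff R _ _ P 'I_n (fun a => [set w | favourite (v w) A (s A) a])
    (0) (margin k eps / Num.sqrt m%:R) k (n %/ k).
  have -> : expR (- (k%:R * margin k eps ^+ 2 / 4 * (n%:R / m%:R))) =
      expR (- (#|'I_n|%:R * k%:R * (margin k eps / Num.sqrt m%:R) ^+ 2 / 4)).
    congr (expR (- _)); move: (margin k eps) => c.
    rewrite card_ord expr_div_n sqr_sqrtr ?ler0n//.
    by field; rewrite lt0r_neq0 ?ltr0n.
  apply => //.
  - by move=> a; exact: measurable_favourite_agent.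
  - by move=> J; exact: iid_law_indep_blocks iidU mS dS.
  - by rewrite card_ord mulnC divnK.
  - by rewrite divr_ge0 ?sqrtr_ge0// ltW// margin_gt0.
  - move=> a.
    apply: (pr_favourite_smallest (iida a) D0 D01 eps0 Deps _ (smin A) sl).
    by case: pA.
apply: (@le_trans _ _ (\sum_A pr P (E A))).
  apply: pr_le_sum => //; first exact: measurable_envy_free_outcome_exists.
  move=> w [C [A [[_ cC pA] ef]]]; exists A; rewrite /E asboolT//.
  exists (C (s A)); first by rewrite cC.
  by move=> a aC j; exact: ef.
apply: (@le_trans _ _ (\sum_(A : {ffun 'I_k -> {set 'I_m}})
    expR (- (k%:R * margin k eps ^+ 2 / 4 * (n%:R / m%:R))))).
  by apply: ler_sum => A _.
rewrite sumr_const card_ffun card_ord -cardsT -powersetT card_powerset cardsT card_ord.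
rewrite /rhs expRD -[leLHS]mulr_natl ler_wpM2r ?expR_ge0//.
rewrite -expnM natrX -(mulr1 (m * k)%:R) expRM_natl lerXn2r ?nnegrE ?expR_ge0//.
by have := expR_ge1Dx (1 : R); lra.
Qed.

End UnionBound.

(* Since [eta <= 1], the last hypothesis gives [x <= eta * (n / x)]. *)
Lemma exponent_small {R : realType} (x n a c e : R) :
  let eta := Num.min 1 (Num.min (c / (2 * a)) (e * c / 4)) in
  0 < a -> 0 < c -> 0 < e -> 1 <= x -> 1 <= n -> x <= eta * Num.sqrt n ->
  expR (x * a - c * (n / x)) < e.
Proof.
move=> eta a0 c0 e0 x1 n1 xn.
have eta0 : 0 < eta.
  by rewrite !lt_min ltr01 !divr_gt0 ?mulr_gt0.
have eta1 : eta <= 1 by rewrite ge_min lexx.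
have etaa : eta <= c / (2 * a) by rewrite !ge_min lexx orbT.
have etae : eta <= e * c / 4 by rewrite !ge_min lexx !orbT.
have x0 : 0 < x by lra.
have n0 : 0 < n by lra.
set r := Num.sqrt n in xn.
have r1 : 1 <= r by rewrite -[leLHS]sqrtr1 /r ler_sqrt// ltW.
have rn : r ^+ 2 = n by rewrite sqr_sqrtr// ltW.
pose y := n / x.
have yx : n = y * x by rewrite /y divfK// lt0r_neq0.
have y0 : 0 < y by rewrite divr_gt0.
have xy : x <= eta * y.
  rewrite -(ler_pM2r x0) -mulrA -yx -rn.
  apply: (@le_trans _ _ ((eta * r) * (eta * r))).
    by apply: ler_pM => //; exact: ltW.
  rewrite (_ : _ * _ = eta * (eta * r ^+ 2)); last by ring.
  by rewrite ler_wpM2l ?(ltW eta0)// ger_pMl// exprn_gt0// (lt_le_trans _ r1).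
(* By [eta <= c / (2 * a)], half of [c * y] absorbs the growing term. *)
have ax : x * a <= c * y / 2.
  apply: (@le_trans _ _ (c / (2 * a) * y * a)).
    by rewrite ler_wpM2r ?(ltW a0)// (le_trans xy)// ler_wpM2r// ltW.
  by rewrite le_eqVlt; apply/orP; left; apply/eqP; field; rewrite lt0r_neq0.
(* From [1 <= x <= eta * y] and [eta <= e * c / 4]; then [c * y / 2 >= 2 / e], so [exp (c * y / 2)]
   exceeds [1 / e]. *)
have ye : 2 / (e * c) * 2 <= y.
  have : 1 <= e * c / 4 * y.
    by apply: (le_trans x1); apply: (le_trans xy); rewrite ler_wpM2r// ltW.
  have ec : 0 < e * c by rewrite mulr_gt0.
  by move=> h; rewrite mulrAC ler_pdivrMr//; lra.
apply: (@le_lt_trans _ _ (expR (- (c * y / 2)))).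
  by rewrite ler_expR -/y; lra.
rewrite expRN -[ltRHS]invrK ltf_pV2 ?posrE ?expR_gt0 ?invr_gt0//.
apply: lt_le_trans (expR_ge1Dx _).
have : 2 / (e * c) * 2 * (c / 2) <= y * (c / 2).
  by rewrite ler_wpM2r// divr_ge0// ltW.
rewrite (_ : 2 / (e * c) * 2 * (c / 2) = 2 * e^-1); last first.
  by field; rewrite !lt0r_neq0.
have : 0 < e^-1 by rewrite invr_gt0.
lra.
Qed.

(** * Passage to the limit along multiples of k *)

Theorem theorem5 (R : realType) (k : nat) (hk : (2 <= k)%N)
  (D : probability (measurableTypeR R) R)
  (D_non_atomic : non_atomic D)
  (D_support : support_of D `<=` `[0, 1]%classic)
  (m : nat -> nat)
  (m_gt0 : forall n, (0 < n)%N -> (k %| n)%N -> (1 <= m n)%N)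
  (m_small : (fun n => (m n)%:R : R^o) =o_ (within [set n | (k %| n)%N] \oo)
             (fun n => Num.sqrt n%:R : R^o))
  (m_ndiv : forall n, (0 < n)%N -> (k %| n)%N -> ~~ (k %| m n)%N)
  (d : nat -> measure_display)
  (Omega : forall n, measurableType (d n))
  (P : forall n, probability (Omega n) R)
  (u : forall n, 'I_n -> 'I_(m n) -> {RV (P n) >-> R})
  (u_iid : forall n, (0 < n)%N -> (k %| n)%N -> iid_utilities D (u n)) :
  P n [set w | ~ envy_free_outcome_exists k (fun a g => u n a g w)]
    @[n --> within [set n | (k %| n)%N] \oo] --> 1%E.
Proof.
have k0 : (0 < k)%N by exact: leq_trans hk.
have D01 : D (~` `[0, 1]%classic) = 0%E.
  by apply: support_complement_null D_support; exact: interval_closed.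
have [eps eps0 Deps] := half_mass_away_from_0 D_non_atomic D01.
pose good n := [set w | ~ envy_free_outcome_exists k (fun a g => u n a g w)].
pose c := k%:R * margin k eps ^+ 2 / 4.
have c0 : 0 < c.
  apply: divr_gt0 => //; apply: mulr_gt0; first by rewrite ltr0n.
  exact: exprn_gt0 (margin_gt0 k0 eps0).
have goodE n : (0 < n)%N -> (k %| n)%N ->
    measurable (good n) /\
    1 - expR ((m n * k)%:R - c * (n%:R / (m n)%:R)) <= pr (P n) (good n).
  move=> n0 kn; have iid := u_iid n n0 kn.
  have mEF := measurable_envy_free_outcome_exists k iid.
  have goodC : good n = setT `\` [set w |
      envy_free_outcome_exists k (fun a g => u n a g w)].
    by apply/seteqP; split=> w //= [].
  split; first by rewrite goodC; exact: measurableD.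
  rewrite goodC pr_setD// {1}/pr probability_setT lerB//.
  exact: (pr_envy_free_le iid D_non_atomic D01 eps0 Deps k0 (m_gt0 n n0 kn) kn
    (m_ndiv n n0 kn)).
apply/fine_cvgP; split.
  rewrite near_withinE; near=> n => kn; rewrite fin_num_measure//.
  by apply: (goodE n _ kn).1; near: n; exact: nbhs_infty_gt.
apply/cvgrPdist_lt => e e0; rewrite near_withinE.
(* The threshold of [exponent_small] with [a = k]; the little-o hypothesis puts [m n] below
   [eta * sqrt n] eventually. *)
pose eta := Num.min 1 (Num.min (c / (2 * k%:R)) (e * c / 4)).
have eta0 : 0 < eta.
  have ck : 0 < c / (2 * k%:R) by apply: divr_gt0 => //; rewrite mulr_gt0 ?ltr0n.
  have ec : 0 < e * c / 4 by apply: divr_gt0 => //; exact: mulr_gt0.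
  by rewrite !lt_min ltr01 ck ec.
have := m_small.
move=> /eqoP /(_ eta eta0); rewrite near_withinE => small.
near=> n => kn.
have n0 : (0 < n)%N by near: n; exact: nbhs_infty_gt.
have [mg lb] := goodE n n0 kn.
have mn : (m n)%:R <= eta * Num.sqrt n%:R.
  have : [set n | (k %| n)%N] n ->
      `|(m n)%:R : R^o| <= eta * `|Num.sqrt n%:R : R^o|.
    by near: n.
  by move=> /(_ kn); rewrite ger0_norm// ger0_norm ?sqrtr_ge0.
have ub : pr (P n) (good n) <= 1 by exact: pr_le1.
rewrite ger0_norm ?subr_ge0//.
have := @exponent_small R (m n)%:R n%:R k%:R c e.
move=> /(_ _ c0 e0 _ _ mn); rewrite ltr0n k0 !ler1n n0 m_gt0// => /(_ isT isT isT).
move=> small_exp; move: lb; rewrite natrM => lb.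
rewrite -[X in 1 - X]/(pr (P n) (good n)).
by apply: le_lt_trans small_exp; rewrite lerBlDr -lerBlDl.
Unshelve. all: by end_near.
Qed.
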